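(* Let $T$ be a finite tree, and let $\beta$ be an integer with $0\le\beta\le\iota(T)$. If $\mathcal{G}$ is a finite abelian group with $\ell(T)-2-\beta$ invariant factors, then there is a subdivision $\widetilde{T}$ of $T$ with $\iota(\widetilde{T})=\beta$ and an arithmetical structure on $\widetilde{T}$ whose critical group is isomorphic to $\mathcal{G}$.
   Context: $\ell(T)$ is the number of leaves of $T$. A subdivision of $T$ is a tree obtained by repeatedly replacing an edge by a path of length $2$ through a new vertex. An arithmetical structure on a tree $T$ is a pair $(\mathbf{d},\mathbf{r})$ with $\mathbf{d}\in\mathbb{Z}_{\ge0}^{V(T)}$, $\mathbf{r}\in\mathbb{Z}_{>0}^{V(T)}$ whose entries have no nontrivial common factor, and $(\operatorname{diag}(\mathbf{d})-A(T))\mathbf{r}=\mathbf{0}$; its critical group is the torsion subgroup of $\mathbb{Z}^{V(T)}/\operatorname{im}(\operatorname{diag}(\mathbf{d})-A(T))$. The number of invariant factors of a finite abelian group is the number of nontrivial cyclic factors in its invariant factor decomposition. A starlike tree is a tree with exactly one vertex of degree at least $3$ (its central vertex). If a tree $T$ has at least two vertices of degree at least $3$, a starlike splitting of $T$ is a $4$-tuple $(S,T',v_s,v_t)$ where $S$ is a starlike tree, $T'$ is a tree, $v_s$ is a leaf of $S$ adjacent to the central vertex of $S$, $v_t\in V(T')$, and $T$ is obtained from $S$ and $T'$ by identifying $v_s$ with $v_t$; it is regular if $v_t$ has degree $1$ in $T'$ and irregular otherwise. Repeatedly applying starlike splittings (to the remaining tree $T'$) until the remaining tree is a starlike tree or a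 path graph yields a starlike decomposition of $T$. The splitting irregularity number $\iota(T)$ is the number of irregular splittings in such a sequence; it does not depend on the sequence chosen. *)

(* Defs.v *)
From HB Require Import structures.
From mathcomp Require Import all_boot all_order all_algebra.
From mathcomp Require Import all_fingroup all_solvable.
From mathcomp Require Import boolp classical_sets.

Set Implicit Arguments.
Unset Strict Implicit.
Unset Printing Implicit Defensive.

Import GRing.Theory.

Local Open Scope nat_scope.

Record sgraph := SGraph {
  vertex :> finType;
  adj : rel vertex;
  adj_sym : symmetric adj;
  adj_irrefl : irreflexive adj }.

Arguments adj {s} x y.
Arguments SGraph : clear implicits.

Definition giso (G H : sgraph) : Prop :=
  exists f : G -> H, bijective f /\ (forall x y, adj (f x) (f y) = adj x y).

Definition deg (G : sgraph) (x : G) : nat := #|[set y | adj x y]|.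

Arguments deg {G} x.

Definition leaves (G : sgraph) : {set G} := [set x | deg x == 1].

Definition nleaves (G : sgraph) : nat := #|leaves G|.

(* One- and two-element cyclic sequences are not cycles of a simple graph. *)
Definition acyclic (G : sgraph) : Prop :=
  forall c : seq G, ucycle adj c -> size c < 3.

Definition is_tree (G : sgraph) : Prop :=
  [/\ 0 < #|G|, forall x y : G, connect adj x y & acyclic G].

Section PathGraph.
Variable n : nat.

Definition path_adj : rel 'I_n := fun i j => (i.+1 == j) || (j.+1 == i).

Lemma path_adj_sym : symmetric path_adj.
Proof. by move=> i j; rewrite /path_adj orbC. Qed.

Lemma path_adj_irrefl : irreflexive path_adj.
Proof. by move=> i; rewrite /path_adj orbb eqn_leq ltnn. Qed.

Definition path_graph : sgraph := SGraph 'I_n path_adj path_adj_sym path_adj_irrefl.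

End PathGraph.

Definition is_path_graph (G : sgraph) : Prop :=
  exists n : nat, giso G (path_graph n.+1).

Section SubdivideEdge.
Variables (G : sgraph) (a b : G).

(* [None] is the new vertex, placed in the middle of the edge {a, b}. *)
Definition subdivide_adj : rel (option G) := fun u v =>
  match u, v with
  | Some x, Some y =>
      adj x y && ~~ ((x == a) && (y == b) || (x == b) && (y == a))
  | Some x, None | None, Some x => (x == a) || (x == b)
  | None, None => false
  end.

Lemma subdivide_adj_sym : symmetric subdivide_adj.
Proof.
move=> [x|] [y|] //=; rewrite adj_sym; congr (_ && ~~ _).
by rewrite orbC; congr (_ || _); rewrite andbC.
Qed.

Lemma subdivide_adj_irrefl : irreflexive subdivide_adj.
Proof. by move=> [x|] //=; rewrite adj_irrefl. Qed.

Definition subdivide_edge : sgraph :=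
  SGraph (option G) subdivide_adj subdivide_adj_sym subdivide_adj_irrefl.

End SubdivideEdge.

Inductive subdivision (G : sgraph) : sgraph -> Prop :=
| subdivision_refl : subdivision G G
| subdivision_step (H : sgraph) (a b : H) :
    subdivision G H -> adj a b -> subdivision G (subdivide_edge a b).

Section Glue.
Variables (G H : sgraph) (s : G) (t : H).

(* The identified vertex is represented by [inl s]; [t] itself is removed. *)
Definition glue_adj : rel (G + {y : H | y != t}) := fun u v =>
  match u, v with
  | inl x, inl y => adj x y
  | inr x, inr y => adj (val x) (val y)
  | inl x, inr y | inr y, inl x => (x == s) && adj t (val y)
  end.

Lemma glue_adj_sym : symmetric glue_adj.
Proof. by move=> [x|x] [y|y] //=; rewrite adj_sym. Qed.

Lemma glue_adj_irrefl : irreflexive glue_adj.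
Proof. by move=> [x|x] /=; rewrite adj_irrefl. Qed.

Definition glue : sgraph :=
  SGraph (G + {y : H | y != t})%type glue_adj glue_adj_sym glue_adj_irrefl.

End Glue.

Definition branching (G : sgraph) : {set G} := [set x | 3 <= deg x].

Definition starlike (S : sgraph) : Prop := is_tree S /\ #|branching S| = 1.

Definition starlike_splitting (T S T' : sgraph) (vs : S) (vt : T') : Prop :=
  [/\ is_tree T /\ 2 <= #|branching T|,
      starlike S,
      is_tree T',
      vs \in leaves S /\ (exists2 c, c \in branching S & adj vs c)
    & giso T (glue vs vt)].

Definition irregular (T' : sgraph) (vt : T') : bool := deg vt != 1.

(* [starlike_decomposition T n]: some starlike decomposition of [T] uses
   exactly [n] irregular splittings. *)
Inductive starlike_decomposition : sgraph -> nat -> Prop :=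
| decomposition_end (T : sgraph) :
    starlike T \/ is_path_graph T -> starlike_decomposition T 0
| decomposition_step (T S T' : sgraph) (vs : S) (vt : T') (n : nat) :
    starlike_splitting T vs vt -> starlike_decomposition T' n ->
    starlike_decomposition T (irregular vt + n).

(* The number of irregular splittings is the same for all starlike
   decompositions of a tree, so for a tree the choice made by [xget] is
   immaterial; the default 0 only matters for graphs that are not trees. *)
Definition iota_split (T : sgraph) : nat :=
  xget 0 [set n | starlike_decomposition T n]%classic.

Section CriticalGroup.
Local Open Scope ring_scope.
Variables (G : sgraph) (d : {ffun G -> int}).

Definition lap_entry (v w : G) : int := (d v) *+ (v == w) - (adj v w)%:R.

(* The matrix diag(d) - A(G), acting on Z^V(G). *)
Definition lap (x : {ffun G -> int}) : {ffun G -> int} :=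
  [ffun v => \sum_w lap_entry v w * x w].

Definition lap_im : {pred {ffun G -> int}} :=
  fun y => `[< exists x, y = lap x >].

Fact lap_im_zmod_closed : zmod_closed lap_im.
Proof.
split=> [|_ _ /asboolP[x ->] /asboolP[y ->]]; apply/asboolP.
  by exists 0; apply/ffunP=> v; rewrite !ffunE big1 // => w _; rewrite ffunE mulr0.
exists (x - y); apply/ffunP=> v; rewrite !ffunE -sumrB.
by apply: eq_bigr => w _; rewrite !ffunE mulrBr.
Qed.

HB.instance Definition _ := GRing.isZmodClosed.Build _ lap_im lap_im_zmod_closed.

Definition lap_coker : zmodType := Quotient.quot lap_im.

Definition lap_torsion : {pred lap_coker} :=
  fun x => `[< exists2 n, (0 < n)%N & x *+ n = 0 >].

Fact lap_torsion_zmod_closed : zmod_closed lap_torsion.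
Proof.
split=> [|x y /asboolP[m m0 xm] /asboolP[n n0 yn]]; apply/asboolP.
  by exists 1%N.
exists (m * n)%N; first by rewrite muln_gt0 m0.
by rewrite mulrnBl mulrnA xm mul0rn mulnC mulrnA yn mul0rn subr0.
Qed.

HB.instance Definition _ :=
  GRing.isZmodClosed.Build _ lap_torsion lap_torsion_zmod_closed.

Record critical_group :=
  CriticalElement { critical_val :> lap_coker; _ : critical_val \in lap_torsion }.

HB.instance Definition _ := [isSub for critical_val].
HB.instance Definition _ := [Choice of critical_group by <:].
HB.instance Definition _ := [SubChoice_isSubZmodule of critical_group by <:].

Definition arithmetical_structure (r : {ffun G -> int}) : Prop :=
  [/\ forall v, 0 <= d v,
      forall v, 0 < r v,
      forall k : nat, (forall v, (k %| r v)%Z) -> k = 1%N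
    & lap r = 0].

End CriticalGroup.

Definition zmod_isomorphic (A B : zmodType) : Prop :=
  exists f : {additive A -> B}, bijective f.

(* [abelian_type] is the list of invariant factors of an abelian group: each
   entry is greater than 1 and divisible by the next one. *)
Definition num_invariant_factors (A : finZmodType) : nat :=
  size (abelian_type [set: A]).

(* Main.v *)
Require Import Defs.
From HB Require Import structures.
From mathcomp Require Import all_boot all_order all_algebra.
From mathcomp Require Import all_fingroup all_solvable.
From mathcomp Require Import boolp zify.

(** On a tree [iota_split] equals [nu], the largest number of edges such that
    every vertex [v] is on at most [deg v - 2] of them.

    Every tree arises from a single vertex by attaching brooms: a star with
    centre [c] and at least two leaves, whose centre is joined to an existing
    vertex [t], or (when [deg t <= 1]) a single leaf.  A group with the right
    number of cyclic factors is built up along this induction.  Suppose that the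
    smaller tree has critical group [B] and that the class of [t] in the
    cokernel is [f].  Given [m_1, ..., m_n], put [M = (m_1 ... m_n)^2], give
    [c] the class [M f], and give the [j]-th leaf the class
    [(M / m_j) f + e_j], where [e_j] is a new element of order [m_j].  The
    remaining branch of [c] starts with a multiple [a u] of
    [u = f + e_1 + ... + e_n], where [a] is congruent to
    [- 1 - M / m_1 - ... - M / m_n] modulo [M] and hence coprime to [M]; it
    is subdivided according to Euclid's algorithm for [M] and [a], ending with
    the class [u].  The critical group becomes the sum of [B] and the groups
    [Z/m_j].  If [deg t >= 2], the edge from [c] to [t] is one more edge
    for [nu]; it is subdivided first if this is not wanted, and then the new
    leaf of the smaller tree allows one more cyclic factor. *)

Set Implicit Arguments.
Unset Strict Implicit.
Unset Printing Implicit Defensive.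

Import GRing.Theory.

Local Open Scope nat_scope.

(** * Trees and attached stars *)

Lemma inj_surj_bij (A B : finType) (f : A -> B) :
  injective f -> (forall y, exists x, f x = y) -> bijective f.
Proof.
move=> injf surjf; apply: inj_card_bij => //.
rewrite -(card_codom injf); apply/subset_leq_card/fintype.subsetP => y _.
by have [x <-] := surjf y; exact: codom_f.
Qed.

Lemma giso_refl (G : sgraph) : giso G G.
Proof. by exists id; split=> //; exists id. Qed.

Lemma giso_sym (G H : sgraph) : giso G H -> giso H G.
Proof.
case=> f [[g fK gK] fadj]; exists g; split; first by exists f.
by move=> x y; rewrite -fadj !gK.
Qed.

Lemma giso_trans (G H K : sgraph) : giso G H -> giso H K -> giso G K.
Proof.
case=> f [bf fadj] [g [bg gadj]]; exists (g \o f); split; first exact: bij_comp.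
by move=> x y; rewrite /= gadj fadj.
Qed.

Lemma giso_inj_surj (G H : sgraph) (f : G -> H) :
  injective f -> (forall y, exists x, f x = y) ->
  (forall x y, adj (f x) (f y) = adj x y) -> giso G H.
Proof. by move=> fi fs fa; exists f; split=> //; exact: inj_surj_bij. Qed.

Section IsoInvariants.
Variables (G H : sgraph) (f : G -> H).
Hypotheses (bf : bijective f) (fadj : forall x y, adj (f x) (f y) = adj x y).

Lemma deg_iso x : deg (f x) = deg x.
Proof.
rewrite /deg -(card_imset _ (bij_inj bf)); apply: eq_card => y.
have [g fK gK] := bf; rewrite inE -[y]gK fadj mem_imset ?inE //; exact: bij_inj.
Qed.

Lemma card_iso (p : pred nat) :
  #|[set x : H | p (deg x)]| = #|[set x : G | p (deg x)]|.
Proof.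
rewrite -[RHS](card_imset _ (bij_inj bf)); apply: eq_card => y.
have [g fK gK] := bf.
by rewrite inE -[y]gK deg_iso mem_imset ?inE //; exact: bij_inj.
Qed.

End IsoInvariants.

Lemma giso_card (G H : sgraph) : giso G H -> #|G| = #|H|.
Proof. by case=> f [bf _]; exact: bij_eq_card bf. Qed.

Lemma giso_branching (G H : sgraph) :
  giso G H -> #|branching H| = #|branching G|.
Proof. by case=> f [bf fa]; exact: (card_iso bf fa (leq 3)). Qed.

Lemma giso_nleaves (G H : sgraph) : giso G H -> nleaves H = nleaves G.
Proof. by case=> f [bf fa]; exact: (card_iso bf fa (pred1 1)). Qed.

Lemma connect_homo (G H : sgraph) (f : G -> H) :
  (forall x y, adj x y -> connect adj (f x) (f y)) ->
  forall x y, connect adj x y -> connect adj (f x) (f y).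
Proof.
move=> fh x y /connectP[p + ->]; elim: p x => [|z p IHp] x //= /andP[xz /IHp].
exact: connect_trans (fh _ _ xz).
Qed.

(** * Acyclicity through vertices with few neighbours *)

Definition nbrs_in (G : sgraph) (W : {set G}) (x : G) := [set y in W | adj x y].

(** Equivalent to [acyclic] by the next two lemmas. In this form acyclicity passes to induced
    subgraphs and to brooms without any manipulation of cycles, and it yields the vertices at which
    a tree can be pruned. *)
Definition degenerate (G : sgraph) :=
  forall W : {set G}, W != set0 -> exists2 x, x \in W & #|nbrs_in W x| <= 1.

(** Take a longest path inside [W]. If every vertex of [W] had two neighbours in [W], the first
    vertex of the path would have a neighbour other than the second one; it would either lengthen
    the path or close a cycle. *)
Lemma acyclic_degenerate (G : sgraph) : acyclic G -> degenerate G.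
Proof.
move=> acG W /set0Pn[w wW].
case: (boolP [exists x in W, #|nbrs_in W x| <= 1]) => [/exists_inP//|].
rewrite negb_exists_in => /forall_inP Wdeg; exfalso.
pose walk n := `[< exists x s, [/\ path adj x s, uniq (x :: s),
                                {subset x :: s <= W} & size s = n] >].
have ex_walk : exists n, walk n.
  exists 0; apply/asboolP; exists w, [::]; split=> // x.
  by rewrite inE => /eqP->.
have walk_bound n : walk n -> n <= #|G|.
  case/asboolP=> x [s [_ us _ <-]]; apply: ltnW.
  by rewrite -[X in X <= _]/(size (x :: s)) -(card_uniqP us) max_card.
case: (ex_maxnP ex_walk walk_bound) => n /asboolP[x [s [ps us sW <-]]] maxn.
have xW : x \in W by apply: sW; rewrite inE eqxx.
(* [head x s] is the second vertex of the path. For empty [s] it is [x], which is not a neighbour of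
   itself, so nothing is lost. *)
have [y] : exists y, y \in nbrs_in W x :\ head x s.
  apply/set0Pn; rewrite -card_gt0; have := Wdeg x xW.
  by rewrite -ltnNge (cardsD1 (head x s)); case: (_ \in _) => /=; lia.
rewrite !inE => /and3P[y_hd yW xy].
have [ys|yNs] := boolP (y \in s); last first.
  have /maxn : walk (size s).+1.
    apply/asboolP; exists y, (x :: s); split=> //.
    - by rewrite /= adj_sym xy.
    - rewrite cons_uniq us andbT inE negb_or yNs andbT.
      by apply: contraTneq xy => ->; rewrite adj_irrefl.
    - by move=> z; rewrite inE => /orP[/eqP->//|/sW].
  by rewrite ltnn.
(* As [y] lies on the path beyond its second vertex, the segment from [x] to [y] closes up to a
   cycle of length at least 3. *)
have := acG (x :: take (index y s).+1 s).
have i_lt : index y s < size s by rewrite index_mem.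
rewrite /= size_takel // => cyc; have {cyc} : (index y s).+2 < 3.
  apply: cyc; apply/andP; split=> /=.
    rewrite rcons_path; apply/andP; split.
      by move: ps; rewrite -{1}(cat_take_drop (index y s).+1 s) cat_path => /andP[].
    by rewrite (last_nth x) size_takel //= nth_take // nth_index // adj_sym.
  move: us; rewrite /= => /andP[xs us]; rewrite take_uniq // andbT.
  by apply: contra xs; exact: mem_take.
case: s ys y_hd {ps us sW maxn i_lt} => //= z s _; rewrite eq_sym => /negPf->.
by lia.
Qed.

(** The predecessor and the successor of a vertex on a cycle of length at least 3 are distinct, so
    the vertex set of the cycle contradicts degeneracy. *)
Lemma degenerate_acyclic (G : sgraph) : degenerate G -> acyclic G.
Proof.
move=> dG c /andP[cyc uc]; rewrite ltnNge; apply/negP => c3.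
have [|x] := dG [set x in c].
  by apply/set0Pn; case: c c3 {cyc uc} => // x c _; exists x; rewrite !inE eqxx.
rewrite inE => xc; rewrite leqNgt => /negP; apply.
have [i s def_s] := seq.rot_to xc.
have sc z : (z \in c) = (z \in x :: s) by rewrite -def_s mem_rot.
have: path.cycle adj (x :: s) by rewrite -def_s rot_cycle.
have: uniq (x :: s) by rewrite -def_s rot_uniq.
have: 2 < size (x :: s) by rewrite -def_s size_rot.
case: s {def_s} sc => [|y s] sc //; case: (lastP s) sc => [|{}s z] sc //= _.
rewrite rcons_path last_rcons => /and3P[_ yz _] /and3P[xy _ zx].
apply: leq_trans (subset_leq_card (_ : [set y; z] \subset _)).
  rewrite cards2; case: eqP yz => // ->; rewrite mem_rcons inE eqxx //.
apply/fintype.subsetP => v /set2P[]->; rewrite !inE sc !inE ?mem_rcons ?inE eqxx ?orbT //=.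
by rewrite adj_sym.
Qed.

Section Broom.
Variables (G : sgraph) (t : G) (J : finType).

(* [inr None] is the centre of the attached star, [inr (Some j)] its leaves;
   for [J := void] a single leaf is attached at [t]. *)
Definition broom_adj : rel (G + option J) := fun u v =>
  match u, v with
  | inl x, inl y => adj x y
  | inl x, inr None | inr None, inl x => x == t
  | inr None, inr (Some _) | inr (Some _), inr None => true
  | _, _ => false
  end.

Lemma broom_adj_sym : symmetric broom_adj.
Proof. by move=> [x|[i|]] [y|[j|]] //=; rewrite adj_sym. Qed.

Lemma broom_adj_irrefl : irreflexive broom_adj.
Proof. by move=> [x|[i|]] //=; rewrite adj_irrefl. Qed.

Definition broom : sgraph :=
  SGraph (G + option J)%type broom_adj broom_adj_sym broom_adj_irrefl.

Lemma card_broom : #|broom| = #|G| + #|J|.+1.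
Proof. by rewrite card_sum card_option. Qed.

Lemma deg_broom_inl x : @deg broom (inl x) = deg x + (x == t).
Proof.
rewrite /deg -!sum1dep_card big_sumType /=; congr (_ + _).
rewrite big_mkcond /= (bigID (pred1 None)) /= big_pred1_eq big1 ?addn0; first by case: (x == t).
by move=> [j|].
Qed.

Lemma deg_broom_center : @deg broom (inr None) = #|J|.+1.
Proof.
rewrite /deg -!sum1dep_card big_sumType /= big_pred1_eq -add1n.
congr (_ + _).
have := cardC1 (None : option J).
rewrite card_option /= => <-; rewrite -sum1_card.
by apply: eq_bigl => -[].
Qed.

Lemma deg_broom_leaf j : @deg broom (inr (Some j)) = 1.
Proof.
rewrite /deg -!sum1dep_card big_sumType /= big_pred0_eq.
by rewrite (big_pred1 None) // => -[].
Qed.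

End Broom.

Lemma tree_connected_to (G : sgraph) (t : G) :
  (forall x, connect adj x t) -> forall x y : G, connect adj x y.
Proof.
move=> ct x y; apply: connect_trans (ct x) _.
by rewrite (sym_connect_sym (@adj_sym G)) ct.
Qed.

Lemma degenerate_sub (G H : sgraph) (f : G -> H) :
  injective f -> (forall x y, adj (f x) (f y) = adj x y) ->
  degenerate H -> degenerate G.
Proof.
move=> fi fa dH W W0; have [|_ /imsetP[x xW ->] le1] := dH (f @: W).
  by rewrite imset_eq0.
exists x => //; apply: leq_trans le1; rewrite -(card_imset _ fi).
apply/subset_leq_card/fintype.subsetP => _ /imsetP[y + ->].
by rewrite !inE fa => /andP[yW ->]; rewrite imset_f.
Qed.

Lemma tree_degenerate (G : sgraph) : is_tree G -> degenerate G.
Proof. by case=> _ _; exact: acyclic_degenerate. Qed.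

Lemma giso_tree (G H : sgraph) : giso G H -> is_tree G -> is_tree H.
Proof.
move=> iGH tG; have [f [bf fa]] := iGH; have [g fK gK] := bf.
have [G0 cG _] := tG; split; first by rewrite -(giso_card iGH).
  move=> x y; rewrite -[x]gK -[y]gK; apply: (connect_homo (f := f)) (cG _ _).
  by move=> u v uv; apply: connect1; rewrite fa.
apply: degenerate_acyclic; apply: degenerate_sub (can_inj gK) _ (tree_degenerate tG).
by move=> x y; rewrite -fa !gK.
Qed.

Lemma path_graph1_tree : is_tree (path_graph 1).
Proof.
split; first by rewrite card_ord.
  by move=> x y; rewrite [x]ord1 [y]ord1 connect0.
by move=> c /andP[_ /card_uniqP <-]; apply: leq_ltn_trans (max_card _) _; rewrite card_ord.
Qed.

Lemma broom_tree (G : sgraph) (t : G) (J : finType) :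
  is_tree G -> is_tree (broom t J).
Proof.
move=> tG; have [G0 cG _] := tG; split; first by rewrite card_broom addn_gt0 G0.
  apply: (@tree_connected_to (broom t J) (inl t)).
  have ct : connect (@adj (broom t J)) (inr None) (inl t).
    by apply: connect1; rewrite /= eqxx.
  case=> [x|[j|]] //; last by apply: connect_trans ct; exact: connect1.
  by apply: (@connect_homo G (broom t J) inl _ x t (cG x t)) => u v uv; exact: connect1.
(* A new leaf in [W] has degree 1; without new leaves, the centre has only [t] as a possible
   neighbour in [W]; otherwise [W] lies in [G]. *)
apply: degenerate_acyclic => W W0.
have [/existsP[j jW]|/existsPn noleaf] := boolP [exists j, inr (Some j) \in W].
  exists (inr (Some j)) => //; rewrite -(deg_broom_leaf t j).
  by apply/subset_leq_card/fintype.subsetP => y; rewrite !inE => /andP[].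
have [cW|cW] := boolP (inr None \in W).
  exists (inr None) => //; rewrite -(cards1 (inl t : broom t J)).
  apply/subset_leq_card/fintype.subsetP => -[x|[j|]]; rewrite !inE //=.
  - by case/andP=> _ /eqP->.
  - by rewrite (negbTE (noleaf j)).
  - by rewrite andbF.
have WE u : u \in W -> exists x, u = inl x.
  case: u => [x|[j|]]; first by exists x.
    by rewrite (negbTE (noleaf j)).
  by rewrite (negbTE cW).
have [|x] := tree_degenerate tG (W := [set x | inl x \in W]).
  by have /set0Pn[u uW] := W0; have [x eu] := WE u uW; apply/set0Pn; exists x; rewrite inE -eu.
rewrite inE => xW le1; exists (inl x) => //; apply: leq_trans le1.
have inlI : injective (inl : G -> broom t J) by move=> ? ? [].
rewrite -(card_imset _ inlI); apply/subset_leq_card/fintype.subsetP => u.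
rewrite inE => /andP[uW]; have [y eu] := WE u uW; rewrite {}eu in uW * => xy.
by rewrite imset_f // !inE uW.
Qed.

Lemma eq_card_bij (J K : finType) : #|J| = #|K| -> exists g : J -> K, bijective g.
Proof.
move=> eJK; exists (fun j => enum_val (cast_ord eJK (enum_rank j))).
exists (fun k => enum_val (cast_ord (esym eJK) (enum_rank k))) => z.
  by rewrite enum_valK cast_ordK enum_rankK.
by rewrite enum_valK cast_ordKV enum_rankK.
Qed.

Lemma giso_broom (G H : sgraph) (f : G -> H) (t : G) (J K : finType) :
  bijective f -> (forall x y, adj (f x) (f y) = adj x y) -> #|J| = #|K| ->
  giso (broom t J) (broom (f t) K).
Proof.
move=> bf fa /eq_card_bij[g bg].
have [f' fK f'K] := bf; have [g' gK g'K] := bg.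
pose F (u : broom t J) : broom (f t) K :=
  match u with inl x => inl (f x) | inr z => inr (omap g z) end.
apply: (giso_inj_surj (f := F)).
- move=> [x|[i|]] [y|[j|]] //=; first by case=> /(bij_inj bf)->.
  by case=> /(bij_inj bg)->.
- case=> [y|[k|]]; [exists (inl (f' y))|exists (inr (Some (g' k)))|by exists (inr None)].
    by rewrite /= f'K.
  by rewrite /= g'K.
by move=> [x|[i|]] [y|[j|]] //=; rewrite (bij_eq bf).
Qed.

Lemma giso_broom_id (G : sgraph) (t : G) (J K : finType) :
  #|J| = #|K| -> giso (broom t J) (broom t K).
Proof. by move=> eJK; apply: (giso_broom (f := id)) => //; exists id. Qed.

(** This links brooms with starlike splittings: the star is a broom over the one-vertex path, and
    that vertex is the leaf to be identified with [t]. *)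
Lemma broom_glue (G : sgraph) (t : G) (J : finType) :
  giso (broom t J)
       (glue (inl ord0 : broom (ord0 : path_graph 1) J) t).
Proof.
pose F (u : broom t J) : glue (inl ord0 : broom (ord0 : path_graph 1) J) t :=
  match u with
  | inl x => if insub x is Some y then inr y else inl (inl ord0)
  | inr z => inl (inr z)
  end.
have Fx x (xt : x != t) : F (inl x) = inr (Sub x xt) by rewrite /F insubT.
have Ft : F (inl t) = inl (inl ord0) by rewrite /F insubF ?eqxx.
apply: (giso_inj_surj (f := F)).
- case=> [x|a] [y|b]; [| | |by case=> ->].
  + have [->|xt] := eqVneq x t; have [->|yt] := eqVneq y t => //; rewrite ?Ft ?Fx //.
    by case=> ->.
  + by have [->|xt] := eqVneq x t; rewrite ?Ft ?Fx.
  + by have [->|xt] := eqVneq y t; rewrite ?Ft ?Fx.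
- case=> [[i|z]|y].
  + by exists (inl t); rewrite Ft [i]ord1.
  + by exists (inr z).
  + by exists (inl (val y)); rewrite (Fx _ (valP y)); congr inr; exact: val_inj.
have Fadj_inr x z : adj (F (inl x)) (F (inr z)) = @adj (broom t J) (inl x) (inr z).
  by have [->|xt] := eqVneq x t; rewrite ?Ft ?Fx //=; case: z => [j|] //=;
     rewrite ?eqxx ?(negbTE xt).
case=> [x|a] [y|b]; last by [].
- have [->|xt] := eqVneq x t; have [->|yt] := eqVneq y t; rewrite ?Ft ?Fx //=.
  + by rewrite adj_irrefl.
  + by rewrite adj_sym.
- exact: Fadj_inr.
- by rewrite adj_sym Fadj_inr adj_sym.
Qed.

(** The [maxn 1] is due to the centre, which is itself a leaf when [J] is empty. *)
Lemma nleaves_broom (G : sgraph) (t : G) (J : finType) :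
  nleaves (broom t J) = #|[set x : G | deg x + (x == t) == 1]| + maxn 1 #|J|.
Proof.
rewrite /nleaves /leaves -!sum1dep_card big_sumType /=; congr (_ + _).
  by apply: eq_bigl => x; rewrite deg_broom_inl.
have -> : \sum_(i : option J | @deg (broom t J) (inr i) == 1) 1 =
   \sum_(i : option J) (@deg (broom t J) (inr i) == 1).
  by rewrite big_mkcond; apply: eq_bigr => i _; case: (_ == _).
rewrite (bigD1 None) //= deg_broom_center.
have -> : \sum_(i : option J | i != None) (@deg (broom t J) (inr i) == 1) = #|J|.
  transitivity (\sum_(i : option J | i != None) 1).
    by apply: eq_bigr => -[j|] //; rewrite deg_broom_leaf.
  rewrite sum1_card; have := cardC1 (None : option J).
  by rewrite card_option /= => <-; apply: eq_card.
by case: #|J| => [|[|n]].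
Qed.

Lemma deg0_tree (G : sgraph) (t : G) : is_tree G -> deg t = 0 -> forall x, x = t.
Proof.
case=> _ cG _ /eqP; rewrite cards_eq0 => /eqP t0 x.
have /connectP[[|y p] //=] := cG t x; case/andP=> ty.
by move/setP/(_ y): t0; rewrite !inE ty.
Qed.

Lemma deg_gt0 (G : sgraph) (t : G) : is_tree G -> 1 < #|G| -> 0 < deg t.
Proof.
move=> tG; rewrite ltnNge lt0n; apply: contra => /eqP/(deg0_tree tG) allt.
by rewrite -(card1 t); apply/subset_leq_card/fintype.subsetP => x _; rewrite (allt x) inE.
Qed.

(* Counting a single vertex as two leaves makes attaching a star to a vertex of
   degree 0 and to one of degree 1 have the same effect. *)
Definition nleaves' (G : sgraph) := nleaves G + 2 * (#|G| == 1).

(** A vertex [t] of degree 1 stops being a leaf. If [t] has degree 0, then [G] is a single vertex,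
    counted as two leaves, and [t] becomes one leaf. Either way one is lost. *)
Lemma nleaves'_broom_lo (G : sgraph) (t : G) (J : finType) :
  is_tree G -> deg t <= 1 -> (nleaves' (broom t J)).+1 = nleaves' G + maxn 1 #|J|.
Proof.
move=> tG dt; have [G0 _ _] := tG; rewrite /nleaves' card_broom.
have -> : (#|G| + #|J|.+1 == 1) = false by apply/negbTE; lia.
rewrite muln0 addn0 nleaves_broom -addSn; congr (_ + _).
move: dt; rewrite leq_eqVlt ltnS leqn0 => /orP[]/eqP dt.
  have -> : (#|G| == 1) = false.
    apply: contra_eqF dt => /eqP/fintype1[z allz].
    by rewrite /deg eq_card0 // => y; rewrite inE (allz y) (allz t) adj_irrefl.
  rewrite muln0 addn0 /nleaves (cardsD1 t (leaves G)) inE dt eqxx add1n; congr _.+1.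
  apply: eq_card => x; rewrite !inE; have [->|xt] := eqVneq x t; first by rewrite dt.
  by rewrite addn0.
have allt := deg0_tree tG dt.
have eq1 : #|G| = 1 by rewrite -(card1 t); apply: eq_card => x; rewrite (allt x) !inE eqxx.
have -> : nleaves G = 0.
  by apply: eq_card0 => x; rewrite (allt x) !inE dt.
rewrite eq1 eqxx add0n muln1; congr _.+1; transitivity #|[set t]|; last exact: cards1.
by apply: eq_card => x; rewrite (allt x) !inE dt eqxx.
Qed.

Lemma nleaves'_broom_hi (G : sgraph) (t : G) (J : finType) :
  1 < deg t -> nleaves' (broom t J) = nleaves' G + maxn 1 #|J|.
Proof.
move=> dt; rewrite /nleaves' card_broom.
have G2 : 1 < #|G| by apply: leq_trans dt (max_card _).
have -> : (#|G| + #|J|.+1 == 1) = false by apply/negbTE; lia.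
have -> : (#|G| == 1) = false by apply/negbTE; lia.
rewrite !muln0 !addn0 nleaves_broom; congr (_ + _).
apply: eq_card => x; rewrite !inE; have [->|_] := eqVneq x t; last by rewrite addn0.
by apply/eqP/eqP; lia.
Qed.

Section Induced.
Variables (G : sgraph) (A : {set G}).

Definition induced : sgraph :=
  SGraph {x | x \in A} (fun x y => adj (val x) (val y))
    (fun x y => adj_sym (val x) (val y)) (fun x => adj_irrefl (val x)).

End Induced.

Lemma leaf_nbr (G : sgraph) (x y z : G) : deg x = 1 -> adj x y -> adj x z -> y = z.
Proof.
move/eqP/cards1P=> [w /setP nx] xy xz.
by have := nx y; have := nx z; rewrite !inE xy xz => /esym/eqP-> /esym/eqP->.
Qed.

(** The smaller tree is induced on what remains after deleting [c] and all its neighbours except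
    [t]. *)
Lemma broom_of_center (T : sgraph) (c t : T) :
  is_tree T -> adj c t -> (forall x, adj c x -> x != t -> deg x = 1) ->
  exists (T' : sgraph) (t' : T'),
    [/\ is_tree T', deg t = (deg t').+1
      & forall J : finType, #|J|.+1 = deg c -> giso T (broom t' J)].
Proof.
move=> tT ct leafc; have [T0 cT _] := tT.
pose A := [set x | (x != c) && ~~ (adj c x && (x != t))].
have tA : t \in A.
  by rewrite inE eqxx andbF andbT; apply: contraTneq ct => ->; rewrite adj_irrefl.
pose t' : induced A := Sub t tA.
have AE x : (x \in A) = (x != c) && ~~ (adj c x && (x != t)) by rewrite inE.
have leafA x y : adj c x -> x != t -> adj x y -> y = c.
  by move=> cx xt xy; apply: (leaf_nbr (leafc x cx xt) xy); rewrite adj_sym.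
have tT' : is_tree (induced A).
  split; first by apply/card_gt0P; exists t'.
    (* A retraction that collapses the deleted vertices to [t']. Since [t] is the only remaining
       vertex with a deleted neighbour, it sends each edge to an edge or to a single vertex, so
       connectedness is inherited. *)
    pose rho x : induced A := insubd t' x.
    have rhoA x : x \in A -> val (rho x) = x by move=> xA; rewrite insubdK.
    have rhoN x : x \notin A -> rho x = t' by move=> xA; rewrite /rho /insubd insubF ?(negbTE xA).
    have rhoN_adj x y : x \notin A -> y \in A -> adj x y -> y = t.
      rewrite !AE negb_and !negbK => /orP[/eqP->|/andP[cx xt]] /andP[yc yt] xy.
        by move: yt; rewrite xy negbK => /eqP.
      by rewrite (leafA x y cx xt xy) eqxx in yc.
    move=> x y; have -> : x = rho (val x) by apply: val_inj; rewrite rhoA ?(valP x).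
    have -> : y = rho (val y) by apply: val_inj; rewrite rhoA ?(valP y).
    apply: (connect_homo _ (cT _ _)) => u v uv.
    have [uA|uA] := boolP (u \in A); have [vA|vA] := boolP (v \in A).
    - by apply: connect1; rewrite /= !rhoA.
    - rewrite adj_sym in uv; rewrite (rhoN v) // (_ : rho u = t') ?connect0 //.
      by apply: val_inj; rewrite rhoA // (rhoN_adj v u).
    - rewrite (rhoN u) // (_ : rho v = t') ?connect0 //.
      by apply: val_inj; rewrite rhoA // (rhoN_adj u v).
    - by rewrite !rhoN.
  apply: degenerate_acyclic.
  by apply: (@degenerate_sub (induced A) T val) (tree_degenerate tT) => //; exact: val_inj.
pose L : finType := {x : T | adj c x && (x != t)}.
pose F (u : broom t' L) : T :=
  match u with inl x => val x | inr None => c | inr (Some j) => val j end.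
have Fi : injective F.
  have inlc (x : induced A) : val x != c by have := valP x; rewrite AE => /andP[].
  have inlL (x : induced A) (j : L) : val x != val j.
    by have := valP x; rewrite AE => /andP[_]; apply: contra => /eqP->; exact: (valP j).
  have Lc (j : L) : val j != c.
    by have /andP[+ _] := valP j; apply: contraTneq => ->; rewrite adj_irrefl.
  move=> [x|[i|]] [y|[j|]] //= /eqP; rewrite ?(negbTE (inlc _)) ?(negbTE (inlL _ _)) //.
  - by move/eqP/val_inj->.
  - by rewrite eq_sym (negbTE (inlL _ _)).
  - by move/eqP/val_inj->.
  - by rewrite (negbTE (Lc _)).
  - by rewrite eq_sym (negbTE (inlc _)).
  - by rewrite eq_sym (negbTE (Lc _)).
have Fs y : exists u, F u = y.
  have [yA|] := boolP (y \in A); first by exists (inl (Sub y yA)).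
  rewrite AE negb_and !negbK => /orP[/eqP->|yL]; first by exists (inr None).
  by exists (inr (Some (Sub y yL))).
have Fa x y : adj (F x) (F y) = adj x y.
  have inl_c (z : induced A) : adj (val z) c = (z == t').
    have := valP z; rewrite AE => /andP[_]; rewrite [adj (val z) c]adj_sym -val_eqE /=.
    have [->|] := eqVneq (val z) t; first by rewrite ct.
    by rewrite andbT => _ /negbTE->.
  have inl_L (z : induced A) (j : L) : adj (val z) (val j) = false.
    apply/negP; rewrite adj_sym => jz; have /andP[cj jt] := valP j.
    by have := valP z; rewrite AE (leafA _ _ cj jt jz) eqxx.
  have L_L (i j : L) : adj (val i) (val j) = false.
    apply/negP => ij; have /andP[ci it] := valP i; have /andP[+ _] := valP j.
    by rewrite (leafA _ _ ci it ij) adj_irrefl.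
  have c_L (j : L) : adj c (val j) by have /andP[] := valP j.
  case: x => [x|[i|]]; case: y => [y|[j|]] //=; rewrite ?inl_c ?inl_L ?L_L ?c_L ?adj_irrefl //;
    rewrite adj_sym ?inl_c ?inl_L ?c_L //.
have bF := inj_surj_bij Fi Fs.
exists (induced A), t'; split=> //.
  by have := deg_iso bF Fa (inl t'); rewrite /= deg_broom_inl eqxx addn1.
move=> J eJ; apply: (giso_trans (H := broom t' L)); last apply: giso_broom_id.
  by apply: giso_sym; exists F.
by have := deg_iso bF Fa (inr None); rewrite deg_broom_center -eJ => -[].
Qed.

(** Degeneracy, applied to the set of non-leaves, gives a vertex [p] with at most one non-leaf
    neighbour. If its degree is at least 3, it is the centre of a star to remove; if it is 2, a
    single leaf at [p] is removed. *)
Lemma tree_structure (T : sgraph) : is_tree T -> 1 < #|T| ->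
  exists (T' : sgraph) (t : T') (n : nat),
    [/\ is_tree T', #|T'| + n < #|T|,
        n = 0 /\ deg t <= 1 \/ 1 < n
      & forall J : finType, #|J| = n -> giso T (broom t J)].
Proof.
move=> tT T2.
have of_center (c t : T) : adj c t -> (forall x, adj c x -> x != t -> deg x = 1) ->
    deg c = 1 /\ deg t <= 2 \/ 2 < deg c ->
    exists (T' : sgraph) (t : T') (n : nat),
    [/\ is_tree T', #|T'| + n < #|T|,
        n = 0 /\ deg t <= 1 \/ 1 < n
      & forall J : finType, #|J| = n -> giso T (broom t J)].
  move=> ct cl cases; have [T' [t' [tT' dt' isoT]]] := broom_of_center tT ct cl.
  have cJ : (deg c).-1.+1 = deg c by case: cases => [[->]|] //; lia.
  exists T', t', (deg c).-1; split=> //.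
  - rewrite (giso_card (isoT 'I_(deg c).-1 _)) ?card_ord //.
    by rewrite card_broom card_ord addnS.
  - by rewrite dt' in cases; case: cases => [[-> le2]|]; [left|right; lia].
  - by move=> J eJ; apply: isoT; rewrite eJ.
have nbr (x : T) : exists y, adj x y.
  by have /card_gt0P[y] := deg_gt0 x tT T2; rewrite inE; exists y.
have [W0|W0] := eqVneq (~: leaves T) set0.
  have all1 (x : T) : deg x = 1.
    have : (x \in ~: leaves T) = false by rewrite W0 inE.
    by rewrite !inE => /negbFE/eqP.
  have [x _] : exists x : T, x \in predT by apply/card_gt0P; case: tT.
  have [y xy] := nbr x; apply: (of_center x y xy) => [z _ _|]; first exact: all1.
  by left; rewrite !all1.
have [p pW le1] := tree_degenerate tT W0.
have dp : 1 < deg p by move: pW; rewrite !inE; have := deg_gt0 p tT T2; lia.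
have leafP x : adj p x -> x \notin nbrs_in (~: leaves T) p -> deg x = 1.
  by rewrite !inE => -> ; rewrite andbT negbK => /eqP.
(* One of the two neighbours of [p] is a leaf [x]. It serves as a centre without leaves attached at
   [p], and its removal leaves [p] with degree 1. *)
have [/eqP dp2|dp2] := boolP (deg p == 2).
  have /card_gt0P[x] : 0 < #|[set x | adj p x] :\: nbrs_in (~: leaves T) p|.
    rewrite cardsD subn_gt0 -/(deg p) dp2 ltnS; apply: leq_trans le1.
    by apply/subset_leq_card/finset.subsetIr.
  rewrite finset.in_setD => /andP[xN]; rewrite inE => px; have dx := leafP x px xN.
  rewrite adj_sym in px; apply: (of_center x p) => //; last by left; rewrite dx dp2.
  by move=> y xy; rewrite (leaf_nbr dx xy px) eqxx.
(* The star with centre [p] hangs at its non-leaf neighbour, or at an arbitrary neighbour if all of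
   them are leaves. *)
have [t [pt tN]] : exists t, adj p t /\ nbrs_in (~: leaves T) p \subset [set t].
  have [N0|/set0Pn[t tN]] := eqVneq (nbrs_in (~: leaves T) p) set0.
    by have [t pt] := nbr p; exists t; rewrite N0 finset.sub0set.
  exists t; move: (tN); rewrite inE => /andP[_ ->]; split=> //.
  move: le1; rewrite leq_eqVlt => /orP[/cards1P[z ez]|].
    by rewrite ez in tN *; move/set1P: tN => ->.
  by rewrite ltnS leqn0 cards_eq0 => /eqP N0; rewrite N0 inE in tN.
apply: (of_center p t) => //; last by right; lia.
move=> x px xt; apply: leafP => //; apply: contra xt => xN.
by have /fintype.subsetP/(_ x xN) := tN; rewrite inE.
Qed.

(** * Subdivisions *)

Lemma deg_subdivide (G : sgraph) (a b x : G) :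
  adj a b -> @deg (subdivide_edge a b) (Some x) = deg x.
Proof.
move=> ab; have aNb : a == b = false by apply: contraTF ab => /eqP->; rewrite adj_irrefl.
(* The bijection between the old and new neighbours of [x]: at an end of the subdivided edge, the
   opposite end is replaced by the new vertex. *)
pose F y : subdivide_edge a b :=
  if (x == a) && (y == b) || (x == b) && (y == a) then None else Some y.
have Fi : {in [set y | adj x y] &, injective F}.
  move=> y z _ _; rewrite /F; case: ifP => [/orP[]/andP[/eqP-> /eqP->]|_]; last first.
    by case: ifP => // _ [].
  - by rewrite eqxx [b == a]eq_sym aNb /=; case: eqP.
  - by rewrite eqxx aNb /= orbF; case: eqP.
rewrite /deg -(card_in_imset Fi); apply: eq_card => v; rewrite inE; apply/idP/imsetP.
  case: v => [y|] /= => [/andP[xy /negbTE xyN]|/orP[]/eqP xE].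
  - by exists y; rewrite ?inE // /F xyN.
  - by exists b; [rewrite inE xE|rewrite /F xE !eqxx].
  - by exists a; [rewrite inE xE adj_sym|rewrite /F xE !eqxx orbT].
case=> y; rewrite inE /F => xy ->; case: ifP => /= [/orP[]/andP[-> _]|->]; rewrite ?orbT //.
by rewrite xy.
Qed.

Lemma giso_subdivide (G H : sgraph) (f : G -> H) (a b : G) :
  bijective f -> (forall x y, adj (f x) (f y) = adj x y) ->
  giso (subdivide_edge a b) (subdivide_edge (f a) (f b)).
Proof.
move=> bf fa; have [g fK gK] := bf.
apply: (@giso_inj_surj (subdivide_edge a b) (subdivide_edge (f a) (f b)) (omap f)).
- by apply: inj_omap; exact: bij_inj.
- by case=> [y|]; [exists (Some (g y)); rewrite /= gK|exists None].
- by move=> [x|] [y|] //=; rewrite ?fa ?(bij_eq bf).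
Qed.

(** The constructors of [subdivision] prescribe the vertex type, so the constructions work up to
    isomorphism and return to [subdivision] at the very end. *)
Definition subdiv (G H : sgraph) :=
  exists2 H0, subdivision G H0 & giso H0 H.

Lemma subdiv_giso (G H : sgraph) : giso G H -> subdiv G H.
Proof. by exists G => //; exact: subdivision_refl. Qed.

Lemma subdiv_giso_r (G H K : sgraph) : subdiv G H -> giso H K -> subdiv G K.
Proof. by case=> H0 sH0 iH iK; exists H0 => //; exact: giso_trans iK. Qed.

Lemma subdiv_step (G H K : sgraph) (a b : H) :
  subdiv G H -> adj a b -> giso (subdivide_edge a b) K -> subdiv G K.
Proof.
case=> H0 sH0 [f [bf fa]] ab iK; have [g fK gK] := bf.
exists (subdivide_edge (g a) (g b)).
  by apply: subdivision_step => //; rewrite -fa !gK.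
by apply: giso_trans iK; have := giso_subdivide (g a) (g b) bf fa; rewrite !gK.
Qed.

Lemma subdiv_edge (G K : sgraph) (a b : G) :
  adj a b -> giso (subdivide_edge a b) K -> subdiv G K.
Proof. by apply: subdiv_step; apply: subdiv_giso; exact: giso_refl. Qed.

Lemma subdiv_trans (G H K : sgraph) : subdiv G H -> subdiv H K -> subdiv G K.
Proof.
move=> sGH [K0 sHK iK]; apply: subdiv_giso_r iK.
elim: K0 / sHK => // K0 a b _ IH ab.
by apply: subdiv_step IH ab _; exact: giso_refl.
Qed.

Lemma broom_subdivide (G : sgraph) (a b t : G) (J : finType) :
  giso (@subdivide_edge (broom t J) (inl a) (inl b))
       (@broom (subdivide_edge a b) (Some t) J).
Proof.
pose F (u : @subdivide_edge (broom t J) (inl a) (inl b)) :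
    @broom (subdivide_edge a b) (Some t) J :=
  match u with
  | Some (inl x) => inl (Some x) | Some (inr z) => inr z | None => inl None
  end.
apply: (giso_inj_surj (f := F)).
- by move=> [[x|i]|] [[y|j]|] //=; case=> ->.
- by case=> [[y|]|j]; [exists (Some (inl y))|exists None|exists (Some (inr j))].
by move=> [[x|[i|]]|] [[y|[j|]]|] //=; rewrite ?andbF ?andbT //= andbT.
Qed.

(** Subdividing commutes with attaching a broom, provided that the attaching vertex is followed
    through the subdivision; its degree does not change. *)
Lemma subdiv_broom (G H : sgraph) : subdiv G H -> forall t : G,
  exists2 t1 : H, deg t1 = deg t &
    forall J : finType, subdiv (broom t J) (broom t1 J).
Proof.
case=> H0 sH0 [f [bf fa]] t.
suff [t1 dt1 st1] : exists2 t1 : H0, deg t1 = deg t &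
    forall J : finType, subdiv (broom t J) (broom t1 J).
  exists (f t1); first by rewrite deg_iso.
  by move=> J; apply: subdiv_giso_r (st1 J) _; exact: giso_broom.
elim: H0 / sH0 {f bf fa} => [|H0 a b _ [t1 dt1 st1] ab].
  by exists t => // J; apply: subdiv_giso; exact: giso_refl.
exists (Some t1); first by rewrite deg_subdivide.
by move=> J; apply: subdiv_step (st1 J) _ (broom_subdivide a b t1 J).
Qed.

(** When the edge at the leaf [x] is subdivided, the new vertex takes over the place of [x], and [x]
    plays the attached leaf. *)
Lemma subdiv_leaf (G : sgraph) (x : G) : deg x = 1 -> subdiv G (broom x void).
Proof.
move=> dx; have /card_gt0P[p] : 0 < #|[set y | adj x y]| by rewrite -/(deg x) dx.
rewrite inE => xp; apply: (subdiv_edge xp).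
have nx y : adj x y = (y == p).
  by apply/idP/eqP => [xy|->//]; exact: leaf_nbr dx xy xp.
have xNp : x == p = false by apply: contraTF xp => /eqP->; rewrite adj_irrefl.
pose F (u : subdivide_edge x p) : broom x void :=
  match u with
  | Some y => if y == x then inr None else inl y
  | None => inl x
  end.
apply: (giso_inj_surj (f := F)).
- move=> [y|] [z|] //=; case: eqVneq => [->|yx] //; try case: eqVneq => [->|zx] //.
  + by case=> ->.
  + by case=> e; rewrite e eqxx in yx.
  + by case=> e; rewrite e eqxx in yx.
- case=> [y|[[]|]]; last by exists (Some x); rewrite /= eqxx.
  have [->|yx] := eqVneq y x; first by exists None.
  by exists (Some y); rewrite /= (negbTE yx).
move=> [y|] [z|] /=; rewrite ?adj_irrefl //.
- have [->|yx] := eqVneq y x; have [->|zx] := eqVneq z x; rewrite /= ?adj_irrefl //.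
  + by rewrite (negbTE zx) nx xNp; case: (z == p).
  + by rewrite (negbTE yx) adj_sym nx /=; case: (y == p).
  + by rewrite andbF andbT.
- have [->|yx] := eqVneq y x; rewrite /= ?eqxx //.
  by rewrite adj_sym nx.
- have [->|yx] := eqVneq z x; rewrite /= ?eqxx //.
Qed.

(** This serves to keep the edge from [t] to the centre from counting in [nu]: the new vertex
    becomes a leaf at [t], and the star hangs at that leaf. *)
Lemma subdiv_broom_edge (G : sgraph) (t : G) (J : finType) :
  subdiv (broom t J) (@broom (broom t void) (inr None) J).
Proof.
apply: (@subdiv_edge (broom t J) _ (inl t) (inr None)); first by rewrite /= eqxx.
pose F (u : @subdivide_edge (broom t J) (inl t) (inr None)) :
    @broom (broom t void) (inr None) J :=
  match u with
  | Some (inl x) => inl (inl x) | Some (inr z) => inr z | None => inl (inr None)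
  end.
apply: (giso_inj_surj (f := F)).
- by move=> [[x|i]|] [[y|j]|] //=; case=> ->.
- by case=> [[y|[[]|]]|j]; [exists (Some (inl y))|exists None|exists (Some (inr j))].
have inlE x y : (inl x == inl y :> broom t J) = (x == y) by apply: inj_eq => ? ? [].
have inlN x : (inl x == inr None :> broom t J) = false by [].
move=> [[x|[i|]]|] [[y|[j|]]|] //=; rewrite ?inlE ?inlN ?andbF ?andbT ?orbF //.
  by case: (x == t).
by case: (y == t).
Qed.

(** * The splitting irregularity number *)

Definition at_vertex (G : sgraph) (B : {set {set G}}) (v : G) :=
  [set e in B | v \in e].

(** Edges are two-element vertex sets. The subtraction is truncated, so a vertex of degree at most 2
    lies on no chosen edge. *)
Definition admissible (G : sgraph) (B : {set {set G}}) :=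
  (forall e, e \in B -> exists x y : G, adj x y /\ e = [set x; y]) /\
  (forall v, #|at_vertex B v| <= deg v - 2).

Definition nu (G : sgraph) :=
  \max_(B : {set {set G}} | `[< admissible B >]) #|B|.

Lemma nu_ge (G : sgraph) (B : {set {set G}}) : admissible B -> #|B| <= nu G.
Proof.
move=> okB; apply: (@bigop.leq_bigmax_cond _ (fun B : {set {set G}} => `[< admissible B >]) (fun B => #|B|)).
exact/asboolP.
Qed.

Lemma nu_ex (G : sgraph) : exists2 B : {set {set G}}, admissible B & #|B| = nu G.
Proof.
have [|B /asboolP okB nuB] := @bigop.eq_bigmax_cond _ (fun B : {set {set G}} => `[< admissible B >]) (fun B => #|B|).
  apply/card_gt0P; exists set0; apply/asboolP; split=> [e|v]; first by rewrite inE.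
  by rewrite (_ : at_vertex _ _ = set0) ?cards0 //; apply/setP => e; rewrite !inE.
by exists B.
Qed.

Lemma admissible_branching (G : sgraph) (B : {set {set G}}) x y :
  admissible B -> [set x; y] \in B -> 2 < deg x.
Proof.
case=> _ /(_ x) le eB; have : 0 < #|at_vertex B x|.
  by apply/card_gt0P; exists [set x; y]; rewrite !inE eB eqxx.
by lia.
Qed.

Lemma admissible_edge (G : sgraph) (B : {set {set G}}) e :
  admissible B -> e \in B ->
  exists x y, [/\ e = [set x; y], adj x y, 2 < deg x & 2 < deg y].
Proof.
move=> okB eB; have [/(_ e eB)[x [y [xy ee]]] _] := okB.
exists x, y; split=> //.
  by apply: (admissible_branching (y := y) okB); rewrite -ee.
by apply: (admissible_branching (y := x) okB); rewrite finset.setUC -ee.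
Qed.

Lemma admissible_sub (G : sgraph) (A B : {set {set G}}) :
  A \subset B -> admissible B -> admissible A.
Proof.
move=> /fintype.subsetP AB [edB degB]; split=> [e /AB/edB//|v].
apply: leq_trans (degB v); apply/subset_leq_card/fintype.subsetP => e.
by rewrite !inE => /andP[/AB-> ->].
Qed.

Section Embedding.
Variables (G H : sgraph) (j : H -> G).
Hypotheses (ji : injective j) (ja : forall x y, adj (j x) (j y) = adj x y).

Definition push (B : {set {set H}}) : {set {set G}} := [set j @: e | e : {set H} in B].
Definition pull (B : {set {set G}}) : {set {set H}} := [set e : {set H} | j @: e \in B].

Lemma card_push B : #|push B| = #|B|.
Proof. by rewrite card_imset //; exact: imset_inj. Qed.

Lemma at_push B y : #|at_vertex (push B) (j y)| = #|at_vertex B y|.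
Proof.
rewrite -(card_imset _ (imset_inj ji)); apply: eq_card => e; rewrite inE.
apply/andP/imsetP => [[/imsetP[e' e'B ->]]|[e']].
  by rewrite mem_imset // => ye'; exists e'; rewrite ?inE ?e'B.
by rewrite inE => /andP[e'B ye'] ->; rewrite !imset_f.
Qed.

Lemma at_pushN B v : (forall y, v != j y) -> at_vertex (push B) v = set0.
Proof.
move=> vN; apply/setP => e; rewrite !inE; apply/andP => -[/imsetP[e' _ ->]].
by case/imsetP=> y _ /eqP; rewrite (negbTE (vN y)).
Qed.

Lemma push_edges (B : {set {set H}}) :
  (forall e, e \in B -> exists x y : H, adj x y /\ e = [set x; y]) ->
  forall e, e \in push B -> exists x y : G, adj x y /\ e = [set x; y].
Proof.
move=> edB _ /imsetP[e /edB[x [y [xy ->]]] ->].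
by exists (j x), (j y); rewrite ja; split=> //; rewrite imsetU1 imset_set1.
Qed.

Lemma at_pull B y : #|at_vertex (pull B) y| <= #|at_vertex B (j y)|.
Proof.
rewrite -(card_imset _ (imset_inj ji)); apply/subset_leq_card/fintype.subsetP => _ /imsetP[e + ->].
by rewrite !inE => /andP[-> ye]; rewrite imset_f.
Qed.

Lemma admissible_pull (B : {set {set G}}) :
  (forall e, e \in B -> exists x y : H, adj x y /\ e = [set j x; j y]) ->
  (forall y, #|at_vertex B (j y)| <= deg y - 2) ->
  admissible (pull B) /\ #|pull B| = #|B|.
Proof.
move=> edB degB; split; first split.
- move=> e; rewrite inE => /edB[x [y [xy ee]]]; exists x, y; split=> //.
  by apply: (imset_inj ji); rewrite ee imsetU1 imset_set1.
- by move=> y; apply: leq_trans (at_pull _ _) _.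
rewrite -(card_imset _ (imset_inj ji)); apply: eq_card => e.
apply/imsetP/idP => [[e']|eB]; first by rewrite inE => ? ->.
have [x [y [xy ee]]] := edB e eB; exists [set x; y]; last by rewrite imsetU1 imset_set1.
by rewrite inE imsetU1 imset_set1 -ee.
Qed.

Lemma nu_embed : (forall y, deg y - 2 <= deg (j y) - 2) -> nu H <= nu G.
Proof.
move=> degj; have [B [edB degB] <-] := nu_ex H; rewrite -card_push.
apply: nu_ge; split; first exact: push_edges.
move=> v; have [/existsP[y /eqP->]|/existsPn vN] := boolP [exists y, v == j y].
  by rewrite at_push; apply: leq_trans (degj y).
by rewrite at_pushN // cards0.
Qed.

(** Both ends of a chosen edge have degree at least 3, so it is enough that such adjacent vertices
    lie in the image of [j]. *)
Lemma nu_restrict :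
  (forall y, deg (j y) - 2 <= deg y - 2) ->
  (forall u v : G, adj u v -> 2 < deg u -> 2 < deg v -> exists y, u = j y) ->
  nu G <= nu H.
Proof.
move=> degj bj; have [B okB <-] := nu_ex G.
have [|y|okB' <-] := @admissible_pull B; last exact: nu_ge.
  move=> e /(admissible_edge okB)[u [v [-> uv du dv]]].
  have [x ex] := bj u v uv du dv; have [|y ey] := bj v u _ dv du; first by rewrite adj_sym.
  by exists x, y; rewrite -ja -ex -ey.
by apply: leq_trans (degj y); case: okB.
Qed.

Variables (c : G) (t : H).
Hypotheses (ct : adj c (j t)) (cN : forall y, c != j y).
Hypothesis degj : forall y, deg (j y) = deg y + (y == t).

Lemma nu_extend_le :
  (forall u v : G, adj u v -> 2 < deg u -> 2 < deg v -> (exists y, u = j y) \/ u = c) ->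
  (forall y, adj c (j y) -> y = t) -> nu G <= (nu H).+1.
Proof.
move=> bj ctN; have [B okB <-] := nu_ex G; set e0 := [set c; j t].
(* Since [j t] has one more neighbour than [t], a chosen set may have to give up one edge at [j t]
   before it can be pulled back: the edge [e0] if it was chosen, else any chosen edge at [j t]. *)
have [B1 [sB1 cB1 e0B1 tB1]] : exists B1 : {set {set G}},
    [/\ B1 \subset B, #|B| <= #|B1|.+1, e0 \notin B1 &
        #|at_vertex B1 (j t)| <= #|at_vertex B (j t)|.-1].
  have rem e1 : e1 \in B -> j t \in e1 -> (e0 \in B -> e1 = e0) ->
      exists B1 : {set {set G}}, [/\ B1 \subset B, #|B| <= #|B1|.+1, e0 \notin B1 &
        #|at_vertex B1 (j t)| <= #|at_vertex B (j t)|.-1].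
    move=> e1B te1 e10; exists (B :\ e1); split; first exact: subD1set.
    - by rewrite (cardsD1 e1) e1B.
    - by rewrite !inE; apply/andP => -[e01 /e10 e1E]; rewrite e1E eqxx in e01.
    - rewrite (cardsD1 e1 (at_vertex B _)) inE e1B te1 /=.
      by apply/subset_leq_card/fintype.subsetP => e; rewrite !inE -andbA.
  have [e0B|e0B] := boolP (e0 \in B); first by apply: (rem e0) => //; rewrite !inE eqxx orbT.
  have [B0|/set0Pn[e1]] := eqVneq (at_vertex B (j t)) set0.
    by exists B; rewrite B0 cards0.
  by rewrite inE => /andP[e1B te1]; apply: (rem e1) => //; rewrite (negbTE e0B).
have okB1 := admissible_sub sB1 okB.
apply: leq_trans cB1 _; rewrite ltnS.
have [|y|okB' <-] := @admissible_pull B1; last exact: nu_ge.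
  move=> e eB1; have [u [v [ee uv du dv]]] := admissible_edge okB1 eB1.
  have vu := uv; rewrite adj_sym in vu; rewrite {}ee in eB1 *.
  have [[x ex]|uc] := bj u v uv du dv; have [[y ey]|vc] := bj v u vu dv du.
  - by exists x, y; rewrite -ja -ex -ey.
  - case/negP: e0B1; rewrite /e0 -vc finset.setUC -(ctN x) -?ex //.
    by rewrite -vc.
  - case/negP: e0B1; rewrite /e0 -uc -(ctN y) -?ey //.
    by rewrite -uc.
  - by rewrite uc vc adj_irrefl in uv.
have [_ degB] := okB; have := degj y; case: eqVneq => [->|_] dj.
  by apply: leq_trans tB1 _; have := degB (j t); lia.
by have [_ degB1] := okB1; have := degB1 (j y); lia.
Qed.

(** Add the edge [e0] to an optimal set of [H]. It uses up the degree gained at [j t], where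
    [1 < deg t] ensures that the truncated bound really grows, and [c] lies on no other chosen
    edge. *)
Lemma nu_extend_ge : 2 < deg c -> 1 < deg t -> (nu H).+1 <= nu G.
Proof.
move=> dc dt; have [B [edB degB] <-] := nu_ex H; set e0 := [set c; j t].
have e0N : e0 \notin push B.
  apply/negP => /imsetP[e _ /setP/(_ c)]; rewrite !inE eqxx /=.
  by move/esym/imsetP=> [y _ /eqP]; rewrite (negbTE (cN y)).
rewrite -card_push -add1n -[X in X + _]/(true : nat) -e0N -cardsU1.
have atU v : #|at_vertex (e0 |: push B) v| <= (v \in e0) + #|at_vertex (push B) v|.
  have [ve|ve] := boolP (v \in e0).
    rewrite (cardsD1 e0); apply: leq_add; first exact: leq_b1.
    by apply/subset_leq_card/fintype.subsetP => e; rewrite !inE; case: eqP.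
  rewrite add0n; apply/subset_leq_card/fintype.subsetP => e; rewrite !inE.
  by case: eqP => // ->; rewrite (negbTE ve).
apply: nu_ge; split.
  by move=> e /setU1P[->|]; [exists c, (j t)|exact: push_edges].
move=> v; apply: leq_trans (atU v) _.
have [/existsP[y /eqP->]|/existsPn vN] := boolP [exists y, v == j y].
  rewrite at_push degj !inE eq_sym (negbTE (cN y)) /= (inj_eq ji).
  by have := degB y; case: eqVneq => [->|_] /=; lia.
rewrite at_pushN // cards0 addn0 !inE (negbTE (vN t)) orbF.
by case: eqVneq => [->|_] /=; lia.
Qed.

End Embedding.

Lemma giso_nu (G H : sgraph) : giso G H -> nu G = nu H.
Proof.
move=> [f [bf fa]]; have [g fK gK] := bf; have fi := bij_inj bf.
apply/eqP; rewrite eqn_leq (nu_embed fi fa) ?(nu_restrict fi fa) // => [x|u v _ _ _|x];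
  rewrite ?deg_iso //.
by exists (g u); rewrite gK.
Qed.

Lemma nu_branching1 (G : sgraph) : #|branching G| <= 1 -> nu G = 0.
Proof.
move=> b1; have [B okB <-] := nu_ex G; apply: eq_card0 => e; apply/negP.
move=> /(admissible_edge okB)[x [y [_ xy dx dy]]].
have /card_le1_eqP eqb := b1; have := eqb x y; rewrite !inE => /(_ dx dy) exy.
by rewrite exy adj_irrefl in xy.
Qed.

(** * Gluing, brooms and [nu] *)

Section GlueDegrees.
Variables (S T : sgraph) (s : S) (t : T).

Lemma deg_glue_inl x : @deg (glue s t) (inl x) = deg x + (x == s) * deg t.
Proof.
rewrite /deg -!sum1dep_card big_sumType /=; congr (_ + _).
have [_|_] /= := eqVneq x s; last by rewrite big_pred0_eq.
rewrite mul1n (reindex_omap (val : {y : T | y != t} -> T) insub) /=.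
  apply: eq_bigl => y; rewrite valK eqxx andbT //.
by move=> y ty; rewrite insubT //; apply: contraTneq ty => ->; rewrite adj_irrefl.
Qed.

Definition glue_inr (y : T) : glue s t :=
  if insub y is Some z then inr z else inl s.

Lemma glue_inrT : glue_inr t = inl s.
Proof. by rewrite /glue_inr insubF ?eqxx. Qed.

Lemma glue_inrN y (yt : y != t) : glue_inr y = inr (Sub y yt).
Proof. by rewrite /glue_inr insubT. Qed.

Lemma glue_inr_val y : glue_inr (val y) = inr y.
Proof. by rewrite (glue_inrN (valP y)); congr inr; exact: val_inj. Qed.

Lemma glue_inr_inj : injective glue_inr.
Proof.
move=> x y; have [->|xt] := eqVneq x t; have [->|yt] := eqVneq y t => //;
  by rewrite ?glue_inrT ?glue_inrN // => -[].
Qed.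

Lemma glue_inr_adj x y : adj (glue_inr x) (glue_inr y) = adj x y.
Proof.
have [->|xt] := eqVneq x t; have [->|yt] := eqVneq y t;
  rewrite ?glue_inrT ?glue_inrN /= ?eqxx ?adj_irrefl //.
by rewrite adj_sym.
Qed.

(** The identified vertex is counted on the side of [T], although [glue] represents it in [S]. *)
Lemma glue_cover (u : glue s t) :
  (exists2 x, x != s & u = inl x) \/ exists y, u = glue_inr y.
Proof.
case: u => [x|y]; last by right; exists (val y); rewrite glue_inr_val.
have [->|xs] := eqVneq x s; last by left; exists x.
by right; exists t; rewrite glue_inrT.
Qed.

Lemma deg_glue_inr y : y != t -> deg (glue_inr y) = deg y.
Proof.
move=> yt; rewrite /deg -(card_imset _ glue_inr_inj); apply: eq_card => u.
rewrite inE; apply/idP/imsetP => [yu|[z yz ->]]; last first.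
  by rewrite glue_inr_adj; rewrite inE in yz.
case: (glue_cover u) => [[x xs eu]|[z eu]]; rewrite eu in yu *.
  by rewrite glue_inrN /= (negbTE xs) in yu.
by exists z; rewrite // inE -glue_inr_adj.
Qed.

End GlueDegrees.

Section NuGlue.
Variables (S T : sgraph) (s c : S) (t : T).
Hypotheses (ds : deg s = 1) (sc : adj s c).
Hypothesis bc : forall x : S, 2 < deg x -> x = c.

Let j := @glue_inr S T s t.
Let ji := @glue_inr_inj S T s t : injective j.
Let ja := @glue_inr_adj S T s t : forall x y, adj (j x) (j y) = adj x y.

Let degj y : deg (j y) = deg y + (y == t).
Proof.
have [->|yt] := eqVneq y t; last by rewrite deg_glue_inr // addn0.
by rewrite /j glue_inrT deg_glue_inl eqxx ds mul1n addnC.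
Qed.

Let cs : c != s. Proof. by apply: contraTneq sc => ->; rewrite adj_irrefl. Qed.

Let ctr : glue s t := inl c.

Let ct : adj ctr (j t). Proof. by rewrite /j glue_inrT /= adj_sym. Qed.

Let cN y : ctr != j y.
Proof.
have [->|yt] := eqVneq y t; last by rewrite /j glue_inrN.
by rewrite /j glue_inrT; apply: contra cs => /eqP[->].
Qed.

Let cover (u : glue s t) : 2 < deg u -> (exists y, u = j y) \/ u = ctr.
Proof.
case: (glue_cover u) => [[x xs ->]|]; last by left.
by rewrite deg_glue_inl (negbTE xs) addn0 => /bc->; right.
Qed.

Let ctN y : adj ctr (j y) -> y = t.
Proof.
by have [->|yt] := eqVneq y t => //; rewrite /j glue_inrN /= (negbTE cs).
Qed.

(** The identified vertex has degree at most 2, so it lies on no chosen edge, and it is the only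
    neighbour of the centre on the side of [T]. *)
Lemma nu_glue_lo : deg t <= 1 -> nu (glue s t) = nu T.
Proof.
move=> dt; apply/eqP; rewrite eqn_leq; apply/andP; split.
  apply: (nu_restrict ji ja) => [y|u v uv du dv].
    by rewrite degj; case: eqVneq => [->|_]; lia.
  case: (cover du) => // eu; case: (cover dv) => [[y ev]|ev]; last first.
    by rewrite eu ev adj_irrefl in uv.
  rewrite eu ev in uv; rewrite ev degj (ctN uv) eqxx in dv; lia.
apply: (nu_embed ji ja) => y; rewrite degj; lia.
Qed.

Lemma nu_glue_hi : 2 < deg c -> 1 < deg t -> nu (glue s t) = (nu T).+1.
Proof.
move=> dc dt; apply/eqP; rewrite eqn_leq; apply/andP; split.
  apply: (nu_extend_le ji ja ct degj) => [u v _ du _|y]; last exact: ctN.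
  exact: cover.
apply: (nu_extend_ge ji ja ct cN degj) => //.
by rewrite deg_glue_inl (negbTE cs) addn0.
Qed.

End NuGlue.

Lemma star_branching (J : finType) (x : broom (ord0 : path_graph 1) J) :
  2 < deg x -> x = inr None.
Proof.
case: x => [i|[j|]] //; last by rewrite deg_broom_leaf.
rewrite deg_broom_inl [i]ord1 /= addn1 /deg eq_card0 // => k.
by rewrite inE [k]ord1 adj_irrefl.
Qed.

Lemma star_deg_root (J : finType) :
  @deg (broom (ord0 : path_graph 1) J) (inl ord0) = 1.
Proof.
rewrite deg_broom_inl eqxx addn1 /deg eq_card0 // => k.
by rewrite inE [k]ord1 adj_irrefl.
Qed.

Lemma star_starlike (J : finType) :
  1 < #|J| -> starlike (broom (ord0 : path_graph 1) J).
Proof.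
move=> J2; split; first by apply: broom_tree; exact: path_graph1_tree.
apply: etrans (cards1 (inr None : broom (ord0 : path_graph 1) J)); apply: eq_card => x.
rewrite !inE; apply/idP/eqP => [/star_branching//|->].
by rewrite deg_broom_center.
Qed.

Lemma nu_broom_lo (G : sgraph) (t : G) (J : finType) :
  deg t <= 1 -> nu (broom t J) = nu G.
Proof.
move=> dt; rewrite (giso_nu (broom_glue t J)).
apply: (nu_glue_lo (c := inr None : broom (ord0 : path_graph 1) J)) => //.
  exact: star_deg_root.
exact: star_branching.
Qed.

Lemma nu_broom_hi (G : sgraph) (t : G) (J : finType) :
  1 < #|J| -> 1 < deg t -> nu (broom t J) = (nu G).+1.
Proof.
move=> J2 dt; rewrite (giso_nu (broom_glue t J)).
apply: (nu_glue_hi (c := inr None : broom (ord0 : path_graph 1) J)) => //.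
- exact: star_deg_root.
- exact: star_branching.
- by rewrite deg_broom_center.
Qed.

(** * Starlike decompositions and [nu] *)

Lemma starlike_center (S : sgraph) (c x : S) :
  starlike S -> c \in branching S -> 2 < deg x -> x = c.
Proof.
case=> _ /eqP/cards1P[z bS]; rewrite bS => /set1P-> dx.
by apply/set1P; rewrite -bS inE.
Qed.

(** If [vt] had degree 0, gluing would add nothing to [S], and [T] would have a single branching
    vertex. Hence irregular means degree at least 2, the case of [nu_glue_hi]. *)
Lemma splitting_deg_gt0 (T S T' : sgraph) (vs : S) (vt : T') :
  starlike_splitting T vs vt -> 0 < deg vt.
Proof.
case=> [[_ b2] sS tT' [+ [c cS cvs]] iT]; rewrite inE => /eqP ds.
rewrite lt0n; apply: contraL b2 => /eqP d0; rewrite -ltnNge ltnS.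
rewrite -(giso_branching iT) -(cards1 (inl c : glue vs vt)).
apply/subset_leq_card/fintype.subsetP => u; rewrite !inE => du.
case: (glue_cover u) => [[x xs eu]|[y eu]]; rewrite eu in du *.
  by rewrite deg_glue_inl (negbTE xs) addn0 in du; rewrite (starlike_center sS cS du).
rewrite (deg0_tree tT' d0 y) glue_inrT in du.
by rewrite deg_glue_inl ds d0 eqxx in du.
Qed.

Lemma path_deg (n : nat) (i : path_graph n) : deg i <= 2.
Proof.
have sub : [set j | adj i j] \subset
    [set j : 'I_n | val j == i.+1] :|: [set j : 'I_n | (val j).+1 == i].
  by apply/fintype.subsetP => j; rewrite !inE /= /path_adj [j == _ :> nat]eq_sym.
apply: leq_trans (subset_leq_card sub) _; apply: leq_trans (leq_card_setU _ _) _.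
apply: (@leq_add _ _ 1 1); apply/card_le1_eqP => j k; rewrite !inE /= => /eqP ej /eqP ek;
  apply: val_inj => /=; lia.
Qed.

(** A splitting raises [nu] by 1 exactly when it is irregular, and starlike trees and paths have no
    edge between two branching vertices. In particular the count does not depend on the
    decomposition. *)
Lemma decomposition_nu (T : sgraph) (n : nat) :
  starlike_decomposition T n -> nu T = n.
Proof.
elim=> {T n} [T TE|T S T' vs vt n sT _ IH].
  apply: nu_branching1; case: TE => [[_ ->]//|[n iT]].
  rewrite -(giso_branching iT) eq_card0 // => x.
  by rewrite !inE ltnNge path_deg.
have vt0 := splitting_deg_gt0 sT.
case: sT => _ sS _ [+ [c cS cvs]] iT; rewrite inE => /eqP ds.
rewrite (giso_nu iT) /irregular; case: eqVneq => [dt|dt] /=.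
  rewrite (nu_glue_lo ds cvs) ?dt // => x; exact: starlike_center.
rewrite (nu_glue_hi ds cvs) ?IH //; first by move=> x; exact: starlike_center.
  by rewrite inE in cS.
by lia.
Qed.

Lemma decomposition_giso (T T' : sgraph) (n : nat) :
  giso T T' -> starlike_decomposition T n -> starlike_decomposition T' n.
Proof.
move=> iT dT; case: dT iT => {T n} [T TE|T S T0 vs vt n [[tT b2] sS tT0 lS iG] dT0] iT.
  apply: decomposition_end; case: TE => [[tT b1]|[n iP]]; [left|right].
    by split; [exact: giso_tree tT|rewrite (giso_branching iT)].
  by exists n; apply: giso_trans iP; exact: giso_sym.
apply: decomposition_step dT0; split; [|exact: sS|exact: tT0|exact: lS|]; last first.
  by apply: giso_trans iG; exact: giso_sym.
by split; [exact: giso_tree tT|rewrite (giso_branching iT)].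
Qed.

Lemma card_branching_leaf (G : sgraph) (t : G) :
  deg t <= 1 -> #|branching (broom t void)| = #|branching G|.
Proof.
move=> dt; rewrite -!sum1dep_card big_sumType /= [X in _ + X]big_pred0 ?addn0.
  apply: eq_bigl => x; rewrite deg_broom_inl; case: eqVneq => [->|_]; lia.
by case=> [[]|]; rewrite deg_broom_center card_void.
Qed.

Lemma path_leaf (n : nat) (t : path_graph n.+1) :
  deg t <= 1 -> giso (broom t void) (path_graph n.+2).
Proof.
move=> dt; have [tn|tn] := eqVneq (val t) n.
  (* Here [t] is the last vertex of the path, and the new vertex is appended; otherwise [t] is the
     first vertex, and the path is shifted by one. *)
  pose F (u : broom t void) : path_graph n.+2 :=
    match u with inl i => widen_ord (leqnSn _) i | inr _ => ord_max end.
  apply: (giso_inj_surj (f := F)).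
  - case=> [i|[[]|]] [k|[[]|]] //= /(congr1 val) /= e.
    + by congr inl; exact: val_inj.
    + by have := ltn_ord i; lia.
    + by have := ltn_ord k; lia.
  - move=> i; have [lt_in|] := ltnP i n.+1.
      by exists (inl (Ordinal lt_in)); exact: val_inj.
    by move=> le_ni; exists (inr None); apply: val_inj => /=; have := ltn_ord i; lia.
  - case=> [i|[[]|]] [k|[[]|]] //=; rewrite /path_adj /=.
    + by rewrite -val_eqE /= tn; have := ltn_ord i; lia.
    + by rewrite -val_eqE /= tn; have := ltn_ord k; lia.
    + by apply/negbTE; lia.
have t0 : val t = 0.
  apply/eqP; rewrite -leqn0 leqNgt; apply/negP => t_gt0; move: dt; rewrite leqNgt.
  have lt_t := ltn_ord t; move: tn t_gt0 lt_t => /= tn t_gt0 lt_t.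
  have lt1 : t.-1 < n.+1 by lia.
  have lt2 : t.+1 < n.+1 by lia.
  move/negP; apply; rewrite -(_ : #|[set Ordinal lt1; Ordinal lt2]| = 2).
    apply/subset_leq_card/fintype.subsetP => x /set2P[]->; rewrite inE /= /path_adj /=; lia.
  rewrite cards2 -val_eqE /=; case: eqP => //; lia.
pose F (u : broom t void) : path_graph n.+2 :=
  match u with inl i => lift ord0 i | inr _ => ord0 end.
apply: (giso_inj_surj (f := F)).
- by case=> [i|[[]|]] [k|[[]|]] //= /lift_inj->.
- move=> i; case: (unliftP ord0 i) => [k ->|->]; first by exists (inl k).
  by exists (inr None).
case=> [i|[[]|]] [k|[[]|]] //=; rewrite /path_adj /= ?/bump /=; rewrite -?val_eqE /= ?t0; lia.
Qed.

Lemma broom_glue_l (S T : sgraph) (s x : S) (t : T) :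
  giso (@broom (glue s t) (inl x) void) (@glue (broom x void) T (inl s) t).
Proof.
pose F (u : @broom (glue s t) (inl x) void) : @glue (broom x void) T (inl s) t :=
  match u with
  | inl (inl y) => inl (inl y) | inl (inr z) => inr z | inr a => inl (inr a)
  end.
apply: (giso_inj_surj (f := F)).
- by case=> [[y|z]|a] [[y'|z']|a'] //= [->].
- by case=> [[y|a]|z]; [exists (inl (inl y))|exists (inr a)|exists (inl (inr z))].
by case=> [[y|z]|[[]|]] [[y'|z']|[[]|]].
Qed.

Lemma broom_glue_r (S T : sgraph) (s : S) (t x : T) : x != t ->
  giso (@broom (glue s t) (glue_inr s t x) void) (@glue S (broom x void) s (inl t)).
Proof.
move=> xt; set G := broom _ _; set H := glue _ _.
have inlP (z : {y : T | y != t}) : (inl (val z) : broom x void) != inl t.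
  by have := valP z; apply: contra => /eqP[zt]; apply/eqP.
pose F (u : G) : H :=
  match u with
  | inl (inl y) => inl y
  | inl (inr z) => inr (Sub (inl (val z)) (inlP z))
  | inr a => inr (Sub (inr a) isT)
  end.
have xE (z : {y : T | y != t}) : (inr z == glue_inr s t x) = (val z == x).
  by rewrite -(glue_inr_val s z) (inj_eq (@glue_inr_inj _ _ _ _)).
apply: (giso_inj_surj (f := F)).
- case=> [[y|z]|a] [[y'|z']|a'] //=; first by case=> ->.
    by case=> /val_inj->.
  by case=> ->.
- case=> [y|[[z|a] zN]]; first by exists (inl (inl y)).
    have zt : z != t by apply: contra zN => /eqP->.
    by exists (inl (inr (Sub z zt))); congr inr; apply: val_inj.
  by exists (inr a); congr inr; apply: val_inj.
have xN y : (inl y == glue_inr s t x) = false by rewrite (glue_inrN s xt).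
case=> [[y|z]|[[]|]] [[y'|z']|[[]|]] //=; rewrite ?xN ?xE ?andbF //=;
  by rewrite [t == x]eq_sym (negbTE xt) andbF.
Qed.

(** The new leaf prolongs an end of either [S] or [T']. In both cases [vs] and [vt] keep their
    degrees, so each splitting keeps its kind. *)
Lemma decomposition_leaf (T : sgraph) (n : nat) :
  starlike_decomposition T n -> forall t : T, deg t <= 1 ->
  starlike_decomposition (broom t void) n.
Proof.
elim=> {T n} [T TE t dt|T S T' vs vt n sT dT' IH t dt].
  apply: decomposition_end; case: TE => [[tT b1]|[n [f [bf fa]]]]; [left|right].
    by split; [exact: broom_tree|rewrite card_branching_leaf].
  have isoT := giso_broom t bf fa (erefl #|{: void}|); exists n.+1; apply: giso_trans isoT _.
  by apply: path_leaf; rewrite deg_iso.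
have vt0 := splitting_deg_gt0 sT.
have [[tT b2] sS tT' [vsS [c cS cvs]] [f [bf fa]]] := sT.
have bT : is_tree (broom t void) /\ 2 <= #|branching (broom t void)|.
  by split; [exact: broom_tree|rewrite card_branching_leaf].
have isoT := giso_broom t bf fa (erefl #|{: void}|).
have dft : deg (f t) <= 1 by rewrite deg_iso.
move: isoT dft; case: (glue_cover (f t)) => [[x xs ->]|[y ->]] isoT.
  rewrite deg_glue_inl (negbTE xs) addn0 => dx.
  apply: (@decomposition_step _ (broom x void) T' (inl vs) vt) => //.
  have [tS bS] := sS.
  split=> //; last exact: giso_trans isoT (broom_glue_l _ _ _).
    by split; [exact: broom_tree|rewrite card_branching_leaf].
  split; first by move: vsS; rewrite !inE deg_broom_inl [vs == x]eq_sym (negbTE xs) addn0.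
  exists (inl c) => //; rewrite inE deg_broom_inl.
  by move: cS; rewrite inE => /leq_trans-> //; exact: leq_addr.
(* The identified vertex has degree [1 + deg vt], which is at least 2, so the new leaf is not
   attached there. *)
have [->|yt] := eqVneq y vt.
  rewrite glue_inrT deg_glue_inl eqxx mul1n.
  by move: vsS; rewrite inE => /eqP->; lia.
rewrite deg_glue_inr // => dy.
have -> : irregular vt = irregular (inl vt : broom y void).
  by rewrite /irregular deg_broom_inl [vt == y]eq_sym (negbTE yt) addn0.
apply: decomposition_step (IH y dy).
split; [exact: bT|exact: sS|exact: broom_tree|by split; [exact: vsS|exists c]|].
exact: giso_trans isoT (broom_glue_r _ yt).
Qed.

(** Induction along [tree_structure]: a single leaf keeps a decomposition, and a star is split off
    as its first piece unless [T] is itself starlike. *)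
Lemma tree_decomposition (T : sgraph) :
  is_tree T -> exists n, starlike_decomposition T n.
Proof.
have [m] := ubnP #|T|; elim: m T => // m IH T lt_T tT.
have [T1|T2] := leqP #|T| 1.
  exists 0; apply: decomposition_end; right; exists 0.
  have eT : #|T| = #|path_graph 1| by rewrite card_ord; case: tT; lia.
  have [f bf] := eq_card_bij eT; exists f; split=> // x y.
  have -> : x = y by apply/eqP; rewrite -(bij_eq bf) [f x]ord1 [f y]ord1.
  by rewrite !adj_irrefl.
have [T' [t [n [tT' lt_T' cases iT]]]] := tree_structure tT T2.
have [|k dT'] := IH T' _ tT'; first lia.
case: cases => [[n0 dt]|n2].
  exists k; apply: decomposition_giso (decomposition_leaf dT' dt).
  by apply/giso_sym/iT; rewrite n0 card_void.
have {}iT := iT 'I_n (card_ord n); have J2 : 1 < #|'I_n| by rewrite card_ord.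
have [b1|b2] := leqP #|branching T| 1.
  exists 0; apply: decomposition_end; left; split=> //.
  apply/eqP; rewrite eqn_leq b1 -(giso_branching iT).
  by apply/card_gt0P; exists (inr None); rewrite inE deg_broom_center.
exists (irregular t + k).
apply: (decomposition_step (vs := inl ord0 : broom (ord0 : path_graph 1) 'I_n)) dT'.
split=> //; first exact: star_starlike.
  split; first by rewrite inE star_deg_root.
  by exists (inr None); rewrite ?inE ?deg_broom_center.
exact: giso_trans iT (broom_glue _ _).
Qed.

Lemma iota_split_nu (T : sgraph) : is_tree T -> iota_split T = nu T.
Proof.
move/tree_decomposition => [n dT]; rewrite (decomposition_nu dT) /iota_split.
apply: classical_sets.xget_subset1 => // k l.
by move=> /decomposition_nu <- /decomposition_nu.
Qed.

(** * Presentations of the cokernel *)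

Import Num.Theory.

Local Open Scope ring_scope.

Lemma sum_option (V : nmodType) (J : finType) (P : pred (option J)) (F : option J -> V) :
  \sum_(o | P o) F o = (if P None then F None else 0) + \sum_(j | P (Some j)) F (Some j).
Proof.
rewrite big_mkcond (bigD1 None) //= [in RHS]big_mkcond; congr (_ + _).
rewrite (reindex_omap Some id) /=; last by case.
by apply: eq_bigl => j; rewrite eqxx.
Qed.

Lemma sum_broom_all (V : nmodType) (G : sgraph) (t : G) (J : finType) (F : broom t J -> V) :
  \sum_v F v = \sum_v F (inl v) + (F (inr None) + \sum_j F (inr (Some j))).
Proof. by rewrite big_sumType /= sum_option. Qed.

Section SumNeighbours.
Variables (V : nmodType) (G : sgraph) (t : G) (J : finType) (F : broom t J -> V).

Lemma sum_nbrs_inl v :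
  \sum_(w | @adj (broom t J) (inl v) w) F w =
  \sum_(w | adj v w) F (inl w) + (if v == t then F (inr None) else 0).
Proof. by rewrite big_sumType /= sum_option /= big_pred0_eq addr0. Qed.

Lemma sum_nbrs_center :
  \sum_(w | @adj (broom t J) (inr None) w) F w = F (inl t) + \sum_j F (inr (Some j)).
Proof. by rewrite big_sumType /= big_pred1_eq sum_option /= add0r. Qed.

Lemma sum_nbrs_leaf j :
  \sum_(w | @adj (broom t J) (inr (Some j)) w) F w = F (inr None).
Proof. by rewrite big_sumType /= big_pred0_eq add0r sum_option /= big_pred0_eq addr0. Qed.

End SumNeighbours.

(** The defining relation at [v] of the cokernel of diag(d) - A(G), for a family [psi] of elements
    in the place of the vertex classes. The next definition is the same relation, read in the
    coordinates of a sum of groups Z/m_k. *)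
Definition harmonic (G : sgraph) (d : G -> int) (C : zmodType) (psi : G -> C) (v : G) :=
  psi v *~ d v = \sum_(w | adj v w) psi w.

Definition harmonic_label (G : sgraph) (d : G -> int) (K : finType) (m : K -> nat)
    (phi : G -> K -> int) (v : G) :=
  forall k, ((m k)%:Z %| phi v k * d v - \sum_(w | adj v w) phi w k)%Z.

Definition generating (G : sgraph) (K : finType) (m : K -> nat) (phi : G -> K -> int) :=
  forall z : K -> int, exists x : G -> int,
    forall k, ((m k)%:Z %| \sum_v x v * phi v k - z k)%Z.

(* [phi v] is the class of the vertex [v] in the cokernel of [diag(d) - A(G)],
   presented as the direct sum of the groups Z/m_k; the coordinate [k0], with
   modulus 0, is the entry of the vector r. *)
Definition realizes (G : sgraph) (K : finType) (k0 : K) (m : K -> nat) :=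
  exists (d : G -> int) (phi : G -> K -> int),
    [/\ forall v, 0 <= d v, forall v, 0 < phi v k0,
        forall v, harmonic_label d m phi v, generating m phi
      & forall (C : zmodType) (psi : G -> C), (forall v, harmonic d psi v) ->
          exists2 z : K -> C, forall k, z k *~ (m k)%:Z = 0 &
            forall v, psi v = \sum_k z k *~ phi v k].

(* A presentation still to be closed by a path attached at [x]: the path
   contributes a common divisor [ups] of the classes of [x] and its neighbour [c]. *)
Definition open_realizes (G : sgraph) (x c : G) (M a : nat) (K : finType) (k0 : K)
    (m : K -> nat) :=
  exists (d : G -> int) (phi : G -> K -> int) (ups : K -> int),
    [/\ [/\ forall v, 0 <= d v, forall v, 0 < phi v k0 & 0 < ups k0],
        forall v, v != x -> harmonic_label d m phi v,
        (forall k, phi x k = ups k *~ a%:Z) /\ (forall k, phi c k = ups k *~ M%:Z),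
        generating m phi
      & forall (C : zmodType) (psi : G -> C) (u : C),
          (forall v, v != x -> harmonic d psi v) ->
          psi x = u *~ a%:Z -> psi c = u *~ M%:Z ->
          exists2 z : K -> C, forall k, z k *~ (m k)%:Z = 0 &
            (forall v, psi v = \sum_k z k *~ phi v k) /\ u = \sum_k z k *~ ups k].

Lemma realizes_bij (G : sgraph) (K L : finType) (g : K -> L) (k0 : K) (m : L -> nat) :
  bijective g -> realizes G k0 (m \o g) -> realizes G (g k0) m.
Proof.
move=> [h gK hK] [d [phi [d0 phi0 hphi gphi uphi]]].
have sumg (C : nmodType) (F : L -> C) : \sum_l F l = \sum_k F (g k).
  by rewrite (reindex g) //=; exists h => k _; rewrite ?gK ?hK.
exists d, (fun v l => phi v (h l)); split=> // [v|v l|z|C psi hpsi].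
- by rewrite gK.
- by have := hphi v (h l); rewrite /= hK.
- have [x xP] := gphi (z \o g); exists x => l.
  by have := xP (h l); rewrite /= hK.
have [z z0 zP] := uphi C psi hpsi; exists (z \o h) => [l|v].
  by have := z0 (h l); rewrite /= hK.
by rewrite sumg zP; apply: eq_bigr => k _; rewrite /= gK.
Qed.

Lemma realizes_point (T : sgraph) (I : finType) (m : option I -> nat) :
  #|T| = 1%N -> #|I| = 0%N -> m None = 0%N -> realizes T (None : option I) m.
Proof.
move=> /fintype1[t allt] /card0_eq I0 m0.
have nadj (v w : T) : adj v w = false by rewrite (allt v) (allt w) adj_irrefl.
have noI (i : I) : False by have := I0 i; rewrite inE.
(* The matrix is the 1 by 1 zero matrix: the cokernel is Z, and the entry of r is 1. *)
exists (fun=> 0), (fun _ _ => 1); split=> //.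
- by move=> v k; rewrite mulr0 big_pred0 ?subr0 ?dvdz0.
- move=> z; exists (fun=> z None) => -[/noI//|].
  rewrite (eq_bigr (fun=> z None)) => [|v _]; last by rewrite mulr1.
  rewrite (eq_bigl (pred1 t)) ?big_pred1_eq ?subrr ?dvdz0 // => v.
  by rewrite (allt v) /= eqxx.
move=> C psi _; exists (fun=> psi t) => [[/noI//|]|v]; first by rewrite m0.
rewrite sum_option /= mulr1z big1 ?addr0 // ?(allt v) // => i _.
Qed.

(** With diagonal entry 1, the new leaf gets the class of [t]; raising the entry at [t] by 1
    compensates for it, and the cokernel stays the same. *)
Lemma realizes_leaf (G : sgraph) (t : G) (K : finType) (k0 : K) (m : K -> nat) :
  realizes G k0 m -> realizes (broom t void) k0 m.
Proof.
move=> [d [phi [d0 phi0 hphi gphi uphi]]].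
exists (fun u => match u with inl v => d v + (v == t)%:R | inr _ => 1 end).
exists (fun u => match u with inl v => phi v | inr _ => phi t end).
split.
- by case=> [v|_] //; rewrite addr_ge0.
- by case=> [v|_].
- case=> [v|[[]|]] k; last by rewrite sum_nbrs_center big1 // addr0 mulr1 subrr dvdz0.
  rewrite sum_nbrs_inl; have [->|_] := eqVneq v t; last by rewrite !addr0; exact: hphi.
  by rewrite mulrDr mulr1 opprD addrACA subrr addr0; exact: hphi.
- move=> z; have [x xP] := gphi z.
  exists (fun u => match u with inl v => x v | inr _ => 0 end) => k.
  by rewrite sum_broom_all [X in _ + (_ + X)]big1 => [|[]]; rewrite // mul0r !addr0; exact: xP.
move=> C psi hpsi.
have psiN : psi (inr None) = psi (inl t).
  by have := hpsi (inr None); rewrite /harmonic sum_nbrs_center big1 // addr0 mulr1z.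
have [v|z z0 zP] := uphi C (psi \o inl).
  have := hpsi (inl v); rewrite /harmonic sum_nbrs_inl /= psiN.
  have [->|_] := eqVneq v t; last by rewrite !addr0.
  by rewrite mulrzDr mulr1z => /addIr.
by exists z => //; case=> [v|[[]|]]; rewrite ?psiN; exact: zP.
Qed.

Lemma generating_extend (G H : sgraph) (j : H -> G) (K : finType) (m : K -> nat)
    (phi : G -> K -> int) :
  injective j -> generating m (phi \o j) -> generating m phi.
Proof.
move=> ji gphi z; have [x xP] := gphi z.
exists (fun v => \sum_(w | j w == v) x w) => k.
rewrite (_ : \sum_v _ = \sum_w x w * phi (j w) k); first exact: xP.
rewrite [RHS](partition_big j predT) //=; apply: eq_bigr => v _.
by rewrite mulr_suml; apply: eq_bigr => w /eqP->.
Qed.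

(** For [a = 1] the class of [x] is [ups] itself, and the missing relation at [x] holds with
    diagonal entry [M], because its only neighbour has class [M] times [ups]. *)
Lemma open_realizes_close (G : sgraph) (x c : G) (M : nat) (K : finType) (k0 : K)
    (m : K -> nat) :
  deg x = 1%N -> adj x c ->
  open_realizes x c M 1 k0 m -> realizes G k0 m.
Proof.
move=> dx xc [d [phi [ups [[d0 phi0 ups0] hphi [phix phic] gphi uphi]]]].
have nbrx (C : nmodType) (F : G -> C) : \sum_(w | adj x w) F w = F c.
  rewrite (big_pred1 c) // => w; apply/idP/eqP => [xw|->//].
  exact: leaf_nbr dx xw xc.
exists (fun v => if v == x then M%:Z else d v), phi; split=> //.
- by move=> v; case: ifP.
- move=> v k; have [->|vx] := eqVneq v x; last exact: hphi.
  by rewrite nbrx phix phic mulr1z mulrzz subrr dvdz0.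
move=> C psi hpsi; have [|||z z0 [zP _]] := uphi C psi (psi x); last by exists z.
- by move=> v vx; have := hpsi v; rewrite /harmonic (negbTE vx).
- by rewrite mulr1z.
by have := hpsi x; rewrite /harmonic eqxx nbrx.
Qed.

(** One Euclidean step: with diagonal entry [e] at [x], the relation there forces the class of the
    new leaf to be [a e - M = b] times [ups], and the pair [M], [a] becomes [a], [b]. *)
Lemma open_realizes_leaf (G : sgraph) (x c : G) (M a e b : nat) (K : finType) (k0 : K)
    (m : K -> nat) :
  deg x = 1%N -> adj x c -> (0 < b)%N -> (b + M = a * e)%N ->
  open_realizes x c M a k0 m ->
  @open_realizes (broom x void) (inr None) (inl x) a b K k0 m.
Proof.
move=> dx xc b0 bM [d [phi [ups [[d0 phi0 ups0] hphi [phix phic] gphi uphi]]]].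
have nbrx (C : nmodType) (F : G -> C) : \sum_(w | adj x w) F w = F c.
  rewrite (big_pred1 c) // => w; apply/idP/eqP => [xw|->//].
  exact: leaf_nbr dx xw xc.
exists (fun u => match u with inl v => if v == x then e%:Z else d v | inr _ => 0 end).
exists (fun u k => match u with inl v => phi v k | inr _ => ups k *~ b%:Z end), ups.
split=> //.
- split=> //; case=> [v|_] //; first by case: ifP.
  by rewrite mulrzz mulr_gt0.
- case=> [v|[[]|]] // _ k; rewrite sum_nbrs_inl.
  have [->|vx] := eqVneq v x; last by rewrite addr0; exact: hphi.
  rewrite nbrx phix phic !mulrzz -mulrA -!PoszM -bM PoszD mulrDr addrC opprD.
  by rewrite [_ + ups k * _]addrC addrACA !addNr dvdz0.
- by apply: (@generating_extend (broom x void) G inl) gphi => u v [].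
move=> C psi u hpsi psix psic.
have [|//||z z0 [zP uE]] := uphi C (psi \o inl) u.
- move=> v vx; have := hpsi (inl v) isT; rewrite /harmonic sum_nbrs_inl /= (negbTE vx).
  by rewrite addr0.
- have := hpsi (inl x) isT; rewrite /harmonic sum_nbrs_inl /= eqxx nbrx psix psic.
  by rewrite -mulrzA -PoszM -bM PoszD mulrzDr [psi (inl c) + _]addrC => /addrI/esym.
exists z => //; split=> //; case=> [v|[[]|]]; first exact: zP.
rewrite psix uE mulrz_suml; apply: eq_bigr => k _.
by rewrite -mulrzA mulrzz.
Qed.

(* The chain of values M, a, ..., 1 produced by Euclid's algorithm. *)
Lemma arm (K : finType) (k0 : K) (m : K -> nat) (a : nat) :
  forall (G : sgraph) (x c : G) (M : nat),
  is_tree G -> deg x = 1%N -> adj x c -> (0 < a)%N -> coprime M a ->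
  open_realizes x c M a k0 m ->
  exists H : sgraph, [/\ subdiv G H, is_tree H, nu H = nu G & realizes H k0 m].
Proof.
have [n] := ubnP a; elim: n a => // n IH a lt_an G x c M tG dx xc a0 copMa oG.
have [a1|a1] := leqP a 1.
  have ea : a = 1%N by lia.
  exists G; split=> //; first by apply: subdiv_giso; exact: giso_refl.
  by apply: (open_realizes_close dx xc (M := M)); rewrite -ea.
have Ma0 : (0 < M %% a)%N.
  by rewrite lt0n; apply: contraTneq copMa => /eqP; rewrite /coprime => /gcdn_idPr->; lia.
have lt_Ma : (M %% a < a)%N by rewrite ltn_mod.
(* Division is rounded up, so that the next multiplier is positive and still less than [a]. *)
have bM : (a - M %% a + M = a * (M %/ a).+1)%N.
  by rewrite {2}(divn_eq M a) mulnS mulnC; lia.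
have b0 : (0 < a - M %% a)%N by lia.
have lb : (a - M %% a < n)%N by lia.
have cop : coprime a (a - M %% a).
  have := copMa; rewrite -coprime_modl.
  move: (M %% a)%N lt_Ma => r lt_ra.
  by rewrite -{1 2}(subnKC (ltnW lt_ra)) /coprime gcdnDl [gcdn (_ + _) _]gcdnC gcdnDr gcdnC.
have [|||H [sH tH nH rH]] := IH _ lb (broom x void) (inr None) (inl x) a _ _ _ b0 cop
   (open_realizes_leaf dx xc b0 bM oG).
- exact: broom_tree.
- by rewrite deg_broom_center card_void.
- by rewrite /= eqxx.
exists H; split=> //; first exact: subdiv_trans (subdiv_leaf dx) sH.
by rewrite nH nu_broom_lo // dx.
Qed.

(** With [M] the square of the product [mm], every [g j = M / m j] is still divisible by [mm]. Hence
    [mm] divides [a + 1], which makes [a] coprime to [mm] and to [M]. The equation for [D] will be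
    the relation at the centre of the star. *)
Lemma star_constants (J : finType) (m : J -> nat) : (forall j, 0 < m j)%N ->
  exists (M D a : nat) (g : J -> nat),
    [/\ (0 < M)%N /\ (0 < a)%N, coprime M a, (a + (1 + \sum_j g j) = D * M)%N,
        forall j, (g j * m j = M)%N
      & (forall i j, m i %| g j)%N].
Proof.
move=> m0; pose mm := (\prod_j m j)%N.
have mm0 : (0 < mm)%N by rewrite prodn_gt0.
have mmj j : (m j %| mm)%N by rewrite /mm (bigD1 j) //= dvdn_mulr.
pose g j := (mm * (mm %/ m j))%N; pose s := (\sum_j g j)%N.
have mms : (mm %| s)%N by apply: dvdn_sum => j _; exact: dvdn_mulr.
(* [D] is chosen large enough for the subtraction not to be truncated and for [a] to be positive. *)
pose D := s.+2; pose a := (D * (mm * mm) - (1 + s))%N.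
have le_D : (s.+2 <= D * (mm * mm))%N by rewrite leq_pmulr // muln_gt0 mm0.
have aE : (a + (1 + s) = D * (mm * mm))%N by rewrite subnK // add1n ltnW.
exists (mm * mm)%N, D, a, g; split=> //.
- by rewrite muln_gt0 mm0 subn_gt0 add1n.
- have mma : (mm %| a.+1)%N.
    by rewrite -(dvdn_addl _ mms) -addn1 -addnA aE mulnA dvdn_mull.
  have cop := coprime_dvdl mma (coprimeSn a).
  by rewrite coprimeMl cop.
- by move=> j; rewrite -mulnA divnK.
- by move=> i j; rewrite dvdn_mulr.
Qed.

(** In the index type [option J] of the leaves, [None] is the start of the remaining branch, and
    each [Some j] brings a new cyclic summand of order [mJ j]. *)
Lemma open_realizes_broom (G : sgraph) (t : G) (K J : finType) (k0 : K)
    (m : K -> nat) (mJ : J -> nat) :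
  (forall j, 0 < mJ j)%N -> realizes G k0 m ->
  exists M a : nat, [/\ (0 < a)%N, coprime M a &
    @open_realizes (broom t (option J)) (inr (Some None)) (inr None) M a (K + J)%type
      (inl k0) (fun k => match k with inl k => m k | inr j => mJ j end)].
Proof.
move=> mJ0 [d [phi [d0 phi0 hphi gphi uphi]]].
have [M [D [a [g [[M0 a0] copMa aE gM mg]]]]] := star_constants mJ0.
have sumgE : (\sum_j g j)%N%:Z = \sum_j (g j)%:Z.
  exact: (big_morph Posz PoszD).
exists M, a; split=> //.
have mM j : (mJ j %| M)%N by rewrite -(gM j) dvdn_mull.
have g0 j : (0 < g j)%N by have := gM j; case: (g j) => //; lia.
(* This is u = f + sum of the e_j, in coordinates: f fills the old ones, and each e_j is a unit
   vector in the new ones. The centre gets [M] times u, which agrees with [M] times f because [M]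
   vanishes modulo each [mJ j]. *)
pose ups (k : K + J) : int := match k with inl k => phi t k | inr _ => 1 end.
pose lbl (u : broom t (option J)) (k : K + J) : int :=
  match u with
  | inl v => if k is inl k then phi v k else 0
  | inr None => ups k *~ M%:Z
  | inr (Some None) => ups k *~ a%:Z
  | inr (Some (Some j)) =>
      match k with inl k => phi t k *~ (g j)%:Z | inr j' => (j == j')%:R end
  end.
(* The additional [M] at [t] cancels the class of the centre. The entry at the first vertex of the
   open branch is a placeholder, as no relation is required there. *)
exists (fun u => match u with
  | inl v => d v + (v == t)%:R * M%:Z | inr None => D%:Z
  | inr (Some None) => 0 | inr (Some (Some j)) => (mJ j)%:Z end).
exists lbl, ups; split=> //.
- split; last exact: phi0.
    by case=> [v|[[j|]|]] //; rewrite addr_ge0 // mulr_ge0.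
  by case=> [v|[[j|]|]] //=; rewrite mulrzz mulr_gt0 // ltz_nat.
- case=> [v|[[j|]|]] // _ k.
  + rewrite sum_nbrs_inl; have [->|_] := eqVneq v t; last first.
      rewrite mul0r !addr0; case: k => [k|j] /=; first exact: hphi.
      by rewrite mul0r big1 // subrr dvdz0.
    case: k => [k|j] /=.
      rewrite mul1r mulrDr mulrzz opprD addrACA subrr addr0; exact: hphi.
    by rewrite mul0r big1 // add0r mulrzz mul1r sub0r rpredN; exact: mM.
  + rewrite sum_nbrs_leaf /=; case: k => [k|j'].
      by rewrite !mulrzz -mulrA -PoszM gM subrr dvdz0.
    rewrite mulrzz mul1r rpredB //; last exact: mM.
    by case: eqVneq => [->|_]; rewrite ?mul1r ?mul0r ?dvdz0.
  + rewrite sum_nbrs_center sum_option /= mulrzz -mulrA -PoszM mulnC -aE.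
    case: k => [k|j] /=.
      rewrite (eq_bigr (fun j => phi t k * (g j)%:Z)) => [|j _]; last by rewrite mulrzz.
      rewrite -mulr_sumr -sumgE mulrzz !PoszD !mulrDr mulr1.
      by rewrite addrCA subrr dvdz0.
    have -> : \sum_i (i == j)%:R = 1 :> int.
      by rewrite (bigD1 j) //= eqxx big1 ?addr0 // => i /negbTE->.
    rewrite mul1r add0r mulrzz mul1r !PoszD addrA [X in X - _]addrC addrK sumgE rpred_sum // => i _; exact: mg.
(* The leaves produce the new coordinates; their contributions to the old ones are subtracted
   beforehand and the rest comes from [G]. *)
- move=> z; have [x xP] := gphi (fun k => z (inl k) - \sum_j z (inr j) * (phi t k * (g j)%:Z)).
  exists (fun u => match u with
    | inl v => x v | inr (Some (Some j)) => z (inr j) | _ => 0 end) => k.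
  rewrite sum_broom_all sum_option /= !mul0r !add0r; case: k => [k|j].
    rewrite (eq_bigr (fun j => z (inr j) * (phi t k * (g j)%:Z))) => [|j _]; last by rewrite mulrzz.
    by have := xP k; rewrite opprB addrA addrAC.
  rewrite big1 => [|v _]; last by rewrite mulr0.
  rewrite add0r (bigD1 j) //= eqxx mulr1 big1 ?addr0 ?subrr ?dvdz0 // => i /negbTE->.
  by rewrite mulr0.
move=> C psi u hpsi psix psic.
pose f := psi (inl t); pose y j := psi (inr (Some (Some j))).
(* The image of e_j. The relation at leaf [j] shows that [mJ j] kills it, and the relation at the
   centre then gives u = f + sum of the [eps j]. *)
pose eps j := y j - u *~ (g j)%:Z.
have eps0 j : eps j *~ (mJ j)%:Z = 0.
  have := hpsi (inr (Some (Some j))) isT; rewrite /harmonic sum_nbrs_leaf psic.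
  by rewrite mulrzBl => ->; rewrite -mulrzA -PoszM gM subrr.
have epsD j n : (mJ j %| n)%N -> eps j *~ n%:Z = 0.
  by case/dvdnP=> q ->; rewrite mulnC PoszM mulrzA eps0 mul0rz.
have fE : u = f + \sum_j eps j.
  have := hpsi (inr None) isT.
  rewrite /harmonic sum_nbrs_center sum_option /= psic psix -mulrzA -PoszM mulnC -aE.
  rewrite -/f !PoszD sumgE !mulrzDr mulr1z [f + (_ + _)]addrCA => /addrI.
  rewrite mulrz_sumr => uE.
  by rewrite (eq_bigr (fun j => y j - u *~ (g j)%:Z)) // sumrB addrA -uE addrK.
have [v|z z0 zP] := uphi C (psi \o inl).
  have := hpsi (inl v) isT; rewrite /harmonic sum_nbrs_inl /=.
  have [->|_] := eqVneq v t; last by rewrite mul0r !addr0.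
  (* So [M] times u equals [M] times f, and the relation at [t] reduces to the one in [G]. *)
  have epsM : (\sum_j eps j) *~ M%:Z = 0.
    by rewrite mulrz_suml big1 // => j _; exact: epsD.
  by rewrite mul1r mulrzDr psic fE mulrzDl epsM addr0 => /addIr.
pose z' (k : K + J) : C := match k with inl k => z k | inr j => eps j end.
have uE : u = \sum_k z' k *~ ups k.
  by rewrite big_sumType /= [LHS]fE; congr (_ + _); exact: zP.
exists z'; first by case=> [k|j] /=.
split=> //; case=> [v|[[j|]|]] /=.
- by rewrite big_sumType /= [X in _ + X]big1 ?addr0 => [|j _]; [exact: zP|rewrite mulr0z].
- rewrite big_sumType /= (bigD1 j) //= eqxx mulr1z [X in _ + (_ + X)]big1; last first.
    by move=> i /negbTE; rewrite eq_sym => ->; rewrite mulr0z.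
  rewrite addr0 -/(y j) (_ : y j = u *~ (g j)%:Z + eps j); last by rewrite addrC subrK.
  congr (_ + _); rewrite uE mulrz_suml big_sumType /= [X in _ + X]big1 ?addr0.
    by apply: eq_bigr => k _; rewrite -mulrzA mulrzz.
  by move=> i _; rewrite mulr1z epsD.
- by rewrite psix uE mulrz_suml; apply: eq_bigr => k _; rewrite -mulrzA mulrzz.
- by rewrite psic uE mulrz_suml; apply: eq_bigr => k _; rewrite -mulrzA mulrzz.
Qed.

(** * Construction of the subdivision *)

Local Open Scope nat_scope.

Definition modulus (I : finType) (m : I -> nat) (k : option I) : nat :=
  if k is Some i then m i else 0.

Definition realizable (T : sgraph) (beta : nat) (I : finType) (m : I -> nat) :=
  exists T1 : sgraph, [/\ subdiv T T1, is_tree T1, nu T1 = beta &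
    realizes T1 (None : option I) (modulus m)].

Lemma realizable_subdiv (T T' : sgraph) (beta : nat) (I : finType) (m : I -> nat) :
  subdiv T T' -> realizable T' beta m -> realizable T beta m.
Proof.
move=> sT [T1 [sT1 tT1 nT1 rT1]]; exists T1; split=> //.
exact: subdiv_trans sT sT1.
Qed.

Lemma nleaves'_point (T : sgraph) : #|T| = 1 -> nleaves' T = 2.
Proof.
move=> T1; rewrite /nleaves' T1 eqxx /nleaves eq_card0 // => x.
have /fintype1[t allt] := T1; rewrite inE /deg eq_card0 // => y.
by rewrite inE (allt x) (allt y) adj_irrefl.
Qed.

Lemma nu_point (T : sgraph) : #|T| = 1 -> nu T = 0.
Proof.
by move=> T1; apply: nu_branching1; apply: leq_trans (max_card _) _; rewrite T1.
Qed.

Lemma giso_nleaves' (G H : sgraph) : giso G H -> nleaves' G = nleaves' H.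
Proof. by move=> iG; rewrite /nleaves' (giso_nleaves iG) (giso_card iG). Qed.

(** It guarantees that the number of factors left for the smaller tree is not a truncated
    difference. Attaching a star raises [nu] only when [deg t] is at least 2, and then at least two
    leaves are gained. *)
Lemma nu_nleaves' (T : sgraph) : is_tree T -> nu T + 2 <= nleaves' T.
Proof.
have [k] := ubnP #|T|; elim: k T => // k IH T lt_T tT.
have [T1|T2] := leqP #|T| 1.
  have {}T1 : #|T| = 1 by case: tT; lia.
  by rewrite nu_point // nleaves'_point.
have [T' [t [n [tT' lt_T' cases iT]]]] := tree_structure tT T2.
have := iT 'I_n (card_ord n) => {}iT.
have leT' : nu T' + 2 <= nleaves' T' by apply: IH => //; lia.
rewrite (giso_nu iT) (giso_nleaves' iT).
have [dt|dt] := leqP (deg t) 1.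
  have := nleaves'_broom_lo 'I_n tT' dt; rewrite nu_broom_lo // card_ord; lia.
case: cases => [[_]|n2]; first by rewrite leqNgt dt.
by rewrite nu_broom_hi ?nleaves'_broom_hi ?card_ord //; lia.
Qed.

(** Of the [n] leaves of the star, one becomes the arm and each of the others brings a cyclic
    factor; the remaining factors are realized on a subdivision of [T]. The hypothesis on [nu]
    covers all ways in which the edge to the centre may count. *)
Lemma realizable_star (T : sgraph) (t : T) (n b beta : nat) :
  (forall (I : finType) (m : I -> nat), (forall i, 0 < m i) ->
     #|I| + 2 + b = nleaves' T -> realizable T b m) ->
  b + 2 <= nleaves' T -> 1 < n ->
  (forall (T1 : sgraph) (t1 : T1) (J : finType),
     nu T1 = b -> deg t1 = deg t -> #|J| = n -> nu (broom t1 J) = beta) ->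
  forall (I : finType) (m : I -> nat), (forall i, 0 < m i) ->
  #|I| + 2 + b + 1 = nleaves' T + n -> realizable (broom t 'I_n) beta m.
Proof.
move=> realT leb n2 nu1 I m m0 cI.
have cI12 : #|{: 'I_(nleaves' T - (b + 2)) + 'I_n.-1}| = #|I|.
  by rewrite card_sum !card_ord; lia.
have [g bg] := eq_card_bij cI12.
have [T1 [sT1 tT1 nT1 rT1]] : realizable T b (fun i => m (g (inl i))).
  by apply: realT => //; rewrite card_ord; lia.
have [t1 dt1 sb] := subdiv_broom sT1 t.
have [|M [a [a0 cop oT]]] := open_realizes_broom t1 (mJ := fun j => m (g (inr j))) _ rT1.
  by [].
have cJ : #|{: option 'I_n.-1}| = n by rewrite card_option card_ord; lia.
have [|||H [sH tH nH rH]] := arm _ _ _ a0 cop oT.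
- exact: broom_tree.
- by rewrite deg_broom_leaf.
- by [].
exists H; split=> //.
- apply: subdiv_trans sH; apply: subdiv_trans (sb _).
  by apply: subdiv_giso; apply: giso_broom_id; rewrite cJ card_ord.
- by rewrite nH nu1.
have [h gK hK] := bg.
pose G (k : option 'I_(nleaves' T - (b + 2)) + 'I_n.-1) : option I :=
  match k with
  | inl None => None | inl (Some i) => Some (g (inl i)) | inr j => Some (g (inr j))
  end.
pose G' (k : option I) : option 'I_(nleaves' T - (b + 2)) + 'I_n.-1 :=
  if k is Some i then
    match h i with inl i => inl (Some i) | inr j => inr j end
  else inl None.
have bG : bijective G.
  exists G'; first by case=> [[i|]|j] //=; rewrite gK.
  by case=> [i|] //=; rewrite -[in RHS](hK i); case: (h i).
apply: (realizes_bij (g := G) (k0 := inl None)) => //.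
move: rH; congr realizes; apply: funext.
by case=> [[i|]|j].
Qed.

Lemma tree_realizable (T : sgraph) : is_tree T ->
  forall (beta : nat) (I : finType) (m : I -> nat), beta <= nu T ->
  (forall i, 0 < m i) -> #|I| + 2 + beta = nleaves' T -> realizable T beta m.
Proof.
have [k] := ubnP #|T|; elim: k T => // k IH T lt_T tT beta I m.
have [T1|T2] := leqP #|T| 1.
  have {}T1 : #|T| = 1 by case: tT; lia.
  rewrite nu_point // nleaves'_point // => b0 m0 cI.
  exists T; split=> //; first by apply: subdiv_giso; exact: giso_refl.
    by rewrite nu_point //; lia.
  by apply: realizes_point => //; lia.
have [T' [t [n [tT' lt_T' cases iT]]]] := tree_structure tT T2.
move=> + m0; have [[n0 dt]|n2] := cases.
  (* A leaf at a vertex of degree at most 1 changes neither [nu], nor [nleaves'], nor the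
     cokernel. *)
  have {}iT := iT void; rewrite n0 card_void in iT; have {}iT := iT erefl.
  have lT := nleaves'_broom_lo void tT' dt; rewrite card_void in lT.
  rewrite (giso_nu iT) (giso_nleaves' iT) nu_broom_lo // => le_b cI.
  have [T1 [sT1 tT1 nT1 rT1]] : realizable T' beta m by apply: IH => //; lia.
  have [t1 dt1 sb] := subdiv_broom sT1 t.
  apply: realizable_subdiv (subdiv_giso iT) _.
  exists (broom t1 void); split; [exact: sb|exact: broom_tree| |exact: realizes_leaf].
  by rewrite nu_broom_lo // dt1.
have {}iT := iT 'I_n (card_ord n).
rewrite (giso_nu iT) (giso_nleaves' iT).
have [dt|dt] := leqP (deg t) 1.
  have := nleaves'_broom_lo 'I_n tT' dt; rewrite nu_broom_lo // card_ord => lT le_b cI.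
  apply: realizable_subdiv (subdiv_giso iT) _.
  apply: (realizable_star (b := beta)) => //; last lia.
  - by move=> I' m' m'0 cI'; apply: IH => //; lia.
  - by have := nu_nleaves' tT'; lia.
  - by move=> T1 t1 J nT1 dt1 _; rewrite nu_broom_lo // dt1.
rewrite nu_broom_hi ?nleaves'_broom_hi ?card_ord //.
(* For positive [beta] the edge from [t] to the centre counts and the smaller tree takes [b]. For 0
   it is subdivided; the induction hypothesis then applies to [broom t void], which still has fewer
   vertices than [T]. *)
case: beta => [|b] le_b cI; apply: realizable_subdiv (subdiv_giso iT) _.
  apply: realizable_subdiv (subdiv_broom_edge _ _) _.
  have lT := nleaves'_broom_hi void dt; rewrite card_void in lT.
  have tT'' : is_tree (broom t void) by exact: broom_tree.
  apply: (realizable_star (b := 0)) => //; last lia.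
  - by move=> I' m' m'0 cI'; apply: IH => //; rewrite card_broom card_void; lia.
  - by have := nu_nleaves' tT''; lia.
  - move=> T1 t1 J nT1 dt1 _; rewrite nu_broom_lo // dt1.
    by rewrite deg_broom_center card_void.
apply: (realizable_star (b := b)) => //; last lia.
- by move=> I' m' m'0 cI'; apply: IH => //; lia.
- by have := nu_nleaves' tT'; lia.
- by move=> T1 t1 J nT1 dt1 cJ; rewrite nu_broom_hi ?nT1 ?cJ ?dt1.
Qed.

(** * The critical group *)

Local Open Scope ring_scope.

Lemma realizes_giso (G H : sgraph) (K : finType) (k0 : K) (m : K -> nat) :
  giso G H -> realizes H k0 m -> realizes G k0 m.
Proof.
case=> f [bf fa] [d [phi [d0 phi0 hphi gphi uphi]]]; have [g fK gK] := bf.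
have sumf (C : nmodType) (P : pred H) (F : H -> C) :
    \sum_(w | P w) F w = \sum_(v | P (f v)) F (f v).
  by rewrite (reindex f) //=; exists g => v _; rewrite ?fK ?gK.
exists (d \o f), (phi \o f); split=> //.
- by move=> v /=.
- by move=> v /=.
- move=> v k; have := hphi (f v) k; rewrite sumf.
  by under eq_bigl do rewrite fa.
- move=> z; have [x xP] := gphi z; exists (x \o f) => k.
  by have := xP k; rewrite sumf.
move=> C psi hpsi; have [w|z z0 zP] := uphi C (psi \o g).
  have := hpsi (g w); rewrite /harmonic /= gK => ->; rewrite sumf.
  by apply: eq_big => v; rewrite /= ?fK // -fa gK.
by exists z => // v; have := zP (f v); rewrite /= fK.
Qed.

(** The decomposition of [abelian_structure], in additive form with integer coefficients; uniqueness
    of the components of 0 gives the second part. *)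
Lemma abelian_basis (A : finZmodType) :
  exists x : 'I_(num_invariant_factors A) -> A,
    (forall a, exists c : 'I_(num_invariant_factors A) -> int, a = \sum_i x i *~ c i) /\
    (forall c : 'I_(num_invariant_factors A) -> int, \sum_i x i *~ c i = 0 ->
       forall i, (#[x i]%g%:Z %| c i)%Z).
Proof.
have [b defA ob] := abelian_structure (FinRing.zmod_abelian [set: A]).
have sb : num_invariant_factors A = size b by rewrite -(size_map order) ob.
rewrite sb; exists (fun i => nth 0 b i).
rewrite (big_nth (0 : A)) big_mkord in defA.
split=> [a|c c0 i].
  have [e [eb -> _]] := mem_bigdprod defA (finset.in_setT a).
  have eP i : exists k : int, e i = nth 0 b i *~ k.
    by have /cycleP[k ek] := eb i isT; exists k%:Z.
  have [k kP] := boolp.choice eP; exists k.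
  by apply: eq_bigr => i _; rewrite kP.
have mem_cyc (y : A) (k : int) : y *~ k \in <[y]>%g.
  by case: k => k; [exact: mem_cycle|rewrite NegzE mulrNz; apply: groupVr; exact: mem_cycle].
have [e [_ _ eU]] := mem_bigdprod defA (finset.in_setT 0).
have e1 : 0 = e i by apply: (eU (fun=> 0)) => // [j _|]; [exact: group1|rewrite big1].
have : nth 0 b i *~ c i = 0.
  rewrite [RHS]e1; apply: (eU (fun i => nth 0 b i *~ c i) _ (esym c0) i isT) => j _.
  exact: mem_cyc.
rewrite dvdzE !absz_nat order_dvdn FinRing.zmodXgE => ci0; apply/eqP.
case: (c i) ci0 => k //=; rewrite NegzE mulrNz => /eqP; rewrite oppr_eq0 => /eqP.
by [].
Qed.

Section Morphism.
Variables (U V : zmodType) (f : U -> V) (fB : zmod_morphism f).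

HB.instance Definition _ := GRing.isZmodMorphism.Build U V f fB.

Lemma zmod_isomorphic_morphism : bijective f -> zmod_isomorphic U V.
Proof. by exists f. Qed.

End Morphism.

Section Cokernel.
Variables (G : sgraph) (d : {ffun G -> int}).

Definition cls (y : {ffun G -> int}) : lap_coker d := \pi_(lap_coker d)%qT y.

Fact cls_is_zmod_morphism : zmod_morphism cls.
Proof. by move=> x y; rewrite /cls !piE. Qed.

HB.instance Definition _ :=
  GRing.isZmodMorphism.Build {ffun G -> int} (lap_coker d) cls cls_is_zmod_morphism.

Lemma cls_surj (q : lap_coker d) : exists y, q = cls y.
Proof. by exists (generic_quotient.repr q); rewrite /cls reprK. Qed.

Lemma cls_eq0 (y : {ffun G -> int}) : cls y = 0 <-> exists x, y = lap d x.
Proof.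
rewrite -(raddf0 cls); split=> [/eqP|[x ->]].
  by rewrite -Quotient.idealrBE subr0 => /asboolP.
by apply/eqP; rewrite -Quotient.idealrBE subr0; apply/asboolP; exists x.
Qed.

Lemma lapE (x : {ffun G -> int}) v :
  lap d x v = x v * d v - \sum_(w | adj v w) x w.
Proof.
rewrite ffunE /lap_entry [in RHS]big_mkcond /=.
rewrite (eq_bigr (fun w => (d v *+ (v == w)) * x w - (if adj v w then x w else 0))).
  rewrite sumrB (bigD1 v) //= eqxx mulr1n big1 ?addr0 1?mulrC // => w.
  by rewrite eq_sym => /negbTE->; rewrite mulr0n mul0r.
by move=> w _; rewrite mulrBl; case: (adj v w); rewrite ?mul1r ?mul0r.
Qed.

(** Symmetry of the matrix: it can be moved onto the labels, so their relations show that each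
    coordinate of an image vector vanishes modulo its modulus. *)
Lemma lap_adjoint (x : {ffun G -> int}) (p : G -> int) :
  \sum_v lap d x v * p v = \sum_v x v * (p v * d v - \sum_(w | adj v w) p w).
Proof.
under eq_bigr do rewrite lapE mulrBl.
under [RHS]eq_bigr do rewrite mulrBr.
rewrite !sumrB; congr (_ - _).
  by apply: eq_bigr => v _; rewrite mulrAC mulrA.
under eq_bigr do rewrite mulr_suml big_mkcond.
under [RHS]eq_bigr do rewrite mulr_sumr big_mkcond.
rewrite exchange_big; apply: eq_bigr => v _; apply: eq_bigr => w _.
by rewrite adj_sym.
Qed.

Definition unit_vec (v : G) : {ffun G -> int} := [ffun w => (w == v)%:R].

(** The relation at [v] is the image of the unit vector at [v]. *)
Lemma harmonic_cls (v : G) : harmonic d (fun w => cls (unit_vec w)) v.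
Proof.
rewrite /harmonic -raddf_sum -raddfMz; apply/eqP; rewrite -subr_eq0 -raddfB.
apply/eqP/cls_eq0; exists (unit_vec v); apply/ffunP => u.
rewrite lapE !ffunE sum_ffunE ffunMzE ffunE; congr (_ - _).
  by have [->|_] := eqVneq u v; rewrite ?mul1r ?mul0r ?mulrzz ?mul1r ?mul0r.
have sum1 (P : pred G) (a : G) : \sum_(w | P w) (w == a)%:R = (P a)%:R :> int.
  rewrite big_mkcond (bigD1 a) //= eqxx big1 ?addr0; first by case: (P a).
  by move=> w /negbTE->; rewrite if_same.
under eq_bigr do rewrite ffunE eq_sym.
under [RHS]eq_bigr do rewrite ffunE.
by rewrite !sum1 adj_sym.
Qed.

Lemma cls_sum (y : {ffun G -> int}) : cls y = \sum_v cls (unit_vec v) *~ y v.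
Proof.
under eq_bigr do rewrite -raddfMz.
rewrite -raddf_sum; congr cls; apply/ffunP => u; rewrite sum_ffunE.
rewrite (bigD1 u) //= big1 => [|v /negbTE vu].
  by rewrite ffunMzE ffunE eqxx addr0 intz.
by rewrite ffunMzE ffunE eq_sym vu mul0rz.
Qed.

End Cokernel.

(** [N k y] is the [k]-th coordinate of the class of [y], and torsion means that coordinate [None]
    vanishes. The other coordinates, used as coefficients of the [x i], give the isomorphism. *)
Lemma critical_group_realizes (G : sgraph) (A : finZmodType) (n : nat)
    (x : 'I_n -> A) (m : 'I_n -> nat) :
  (forall i, 0 < m i)%N -> (forall i, x i *~ (m i)%:Z = 0) ->
  (forall a, exists c : 'I_n -> int, a = \sum_i x i *~ c i) ->
  (forall c : 'I_n -> int, \sum_i x i *~ c i = 0 -> forall i, ((m i)%:Z %| c i)%Z) ->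
  realizes G (None : option 'I_n) (modulus m) ->
  exists d r : {ffun G -> int},
    arithmetical_structure d r /\ zmod_isomorphic (critical_group d) A.
Proof.
move=> m0 mx genx indx [d0 [phi [d_ge0 phi0 hphi gphi uphi]]].
pose d : {ffun G -> int} := finfun d0; pose r : {ffun G -> int} := [ffun v => phi v None].
have dE v : d v = d0 v by rewrite ffunE.
pose N (k : option 'I_n) (y : {ffun G -> int}) := \sum_v y v * phi v k.
have NB k y y' : N k (y - y') = N k y - N k y'.
  by rewrite /N -sumrB; apply: eq_bigr => v _; rewrite !ffunE mulrBl.
have N_lap k y : ((modulus m k)%:Z %| N k (lap d y))%Z.
  rewrite /N lap_adjoint rpred_sum // => v _; rewrite dvdz_mull // dE.
  exact: hphi.
(* The universal property, applied to the cokernel itself, expresses a class through its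
   coordinates; injectivity rests on this. *)
have [z z0 zP] := uphi _ (fun v => cls d (unit_vec v))
  (fun v => etrans (congr1 _ (esym (dE v))) (harmonic_cls d v)).
have clsN y : cls d y = z None *~ N None y + \sum_i z (Some i) *~ N (Some i) y.
  rewrite cls_sum -[RHS](sum_option xpredT (fun k => z k *~ N k y)) /N.
  under [RHS]eq_bigr do rewrite mulrz_sumr.
  rewrite exchange_big; apply: eq_bigr => v _; rewrite zP mulrz_suml.
  by apply: eq_bigr => k _; rewrite -mulrzA mulrC.
have dvd_mul0 (C : zmodType) (c : C) (k : nat) (l : int) :
    c *~ k%:Z = 0 -> (k%:Z %| l)%Z -> c *~ l = 0.
  by move=> ck /dvdzP[q ->]; rewrite mulrC mulrzA ck mul0rz.
pose Phi (y : {ffun G -> int}) := \sum_i x i *~ N (Some i) y.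
have PhiB y y' : Phi (y - y') = Phi y - Phi y'.
  by rewrite /Phi -sumrB; apply: eq_bigr => i _; rewrite NB mulrzBr.
have Phi_cls y y' : cls d y = cls d y' -> Phi y = Phi y'.
  move/eqP; rewrite -subr_eq0 -raddfB => /eqP/cls_eq0[w yy'].
  apply/eqP; rewrite -subr_eq0 -PhiB yy' /Phi big1 // => i _.
  exact: dvd_mul0 (mx i) (N_lap (Some i) w).
exists d, r; split.
  split=> [v|v|k kr|]; first by rewrite dE.
  - by rewrite ffunE.
  (* In coordinate [None], of modulus 0, generation provides an integer combination of the entries
     of r equal to 1, so they have no common factor. *)
  - have [y /(_ None)] := gphi (fun k => if k is None then 1 else 0).
    rewrite dvd0z subr_eq0 => /eqP y1; apply/eqP; rewrite -dvdn1.
    suff : (k%:Z %| (1 : int)%R)%Z by [].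
    rewrite -y1 rpred_sum // => v _.
    by rewrite dvdz_mull //; have := kr v; rewrite ffunE.
  - apply/ffunP => v; rewrite lapE dE [RHS]ffunE ffunE.
    have := hphi v None; rewrite dvd0z => /eqP h0; rewrite -[RHS]h0; congr (_ - _).
    by apply: eq_bigr => w _; rewrite ffunE.
pose f (c : critical_group d) : A := Phi (generic_quotient.repr (critical_val c)).
have fE c y : critical_val c = cls d y -> f c = Phi y.
  by move=> cy; apply: Phi_cls; rewrite -cy /cls generic_quotient.reprK.
have f_morph : zmod_morphism f.
  move=> c c'; have [y yE] := cls_surj (critical_val c).
  have [y' y'E] := cls_surj (critical_val c').
  rewrite (fE _ _ yE) (fE _ _ y'E) -PhiB; apply: fE.
  by rewrite raddfB /= -yE -y'E.
apply: (zmod_isomorphic_morphism f_morph).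
have torN y : cls d y \in @lap_torsion G d -> N None y = 0.
  case/asboolP=> k k0; rewrite -raddfMn => /cls_eq0[w yw].
  have := N_lap None w; rewrite -yw dvd0z.
  rewrite (_ : N None (y *+ k) = N None y *+ k); first by rewrite mulrn_eq0; case: k k0 {yw} => //= k _ /eqP.
  by rewrite /N -sumrMnl; apply: eq_bigr => v _; rewrite ffunMnE mulrnAl.
have inj_f : injective f.
  move=> c c' fcc'; apply/eqP; rewrite -subr_eq0; apply/eqP.
  have fc0 : f (c - c') = 0 by rewrite f_morph fcc' subrr.
  have [y yE] := cls_surj (critical_val (c - c')).
  have ty : cls d y \in @lap_torsion G d by rewrite -yE; exact: (valP (c - c')).
  apply: val_inj; rewrite /= -[LHS]/(critical_val (c - c')) yE clsN torN // mulr0z add0r.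
  rewrite big1 // => i _; apply: dvd_mul0 (z0 (Some i)) _.
  by apply: (indx (fun i => N (Some i) y)); rewrite -[LHS](fE _ _ yE).
have surj_f a : exists c, f c = a.
  have [c ->] := genx a.
  have [y0 y0P] := gphi (fun k => if k is Some i then c i else 0).
  pose y : {ffun G -> int} := finfun y0.
  have NE k : N k y = \sum_v y0 v * phi v k by apply: eq_bigr => v _; rewrite ffunE.
  have ty : cls d y \in @lap_torsion G d.
    apply/asboolP; exists (\prod_i m i)%N; first by rewrite prodn_gt0.
    have := y0P None; rewrite dvd0z subr0 -NE => /eqP y0N.
    rewrite clsN y0N mulr0z add0r -sumrMnl big1 // => i _.
    rewrite -[_ *+ _]/(_ *~ Posz _) -mulrzA; apply: dvd_mul0 (z0 (Some i)) _.
    by rewrite dvdz_mull // (bigD1 i) //= PoszM dvdz_mulr.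
  exists (CriticalElement ty); rewrite (fE _ y) //; apply: eq_bigr => i _.
  apply/eqP; rewrite -subr_eq0 -mulrzBr NE; apply/eqP.
  exact: dvd_mul0 (mx i) (y0P (Some i)).
have [g gK] := boolp.choice surj_f.
by exists g => // c; apply: inj_f; rewrite gK.
Qed.

Theorem theorem7p2 (T : sgraph) (beta : nat) (A : finZmodType) :
  is_tree T ->
  (beta <= iota_split T)%N ->
  ((num_invariant_factors A)%:Z = (nleaves T)%:Z - 2 - beta%:Z)%R ->
  exists (T1 : sgraph) (d r : {ffun T1 -> int}),
    [/\ subdivision T T1,
        iota_split T1 = beta,
        arithmetical_structure d r
      & zmod_isomorphic (critical_group d) A].
Proof.
move=> tT; rewrite iota_split_nu // => le_beta cardA.
(* The two counts differ only for a single vertex, where the number of invariant factors would have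
   to be negative. *)
have lT : nleaves' T = nleaves T.
  have := @nleaves'_point T; rewrite /nleaves'.
  by case: eqP => [-> /(_ erefl)|_ _]; lia.
have [x [genx indx]] := abelian_basis A.
have [||H [[T0 sT0 iT0] tH nH rH]] := tree_realizable (m := fun i => #[x i]%g) tT le_beta.
- by move=> i; exact: order_gt0.
- by rewrite card_ord lT; lia.
have tT0 := giso_tree (giso_sym iT0) tH.
have [|i|d [r [asdr isoA]]] := critical_group_realizes _ _ genx indx (realizes_giso iT0 rH).
- by move=> i; exact: order_gt0.
- by rewrite -[_ *~ _]/(x i *+ #[x i]%g) -FinRing.zmodXgE expg_order.
exists T0, d, r; split=> //.
by rewrite iota_split_nu // (giso_nu iT0).
Qed.
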